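(* Let $(\Omega,\Lambda)$ be a spectral pair such that $\Omega$ is a bounded region in $\mathbb{R}$ and $\Lambda$ is $d$-periodic. Then there exists a disjoint partition of $[0,1/d)$ into a finite number of sets $E_1,E_2,\dots,E_k$ such that $\Omega=\bigcup_{j=1}^k (E_j+A_j)$ with $A_j\subseteq \mathbb{Z}/d$ for each $j$. Further, each set $\Omega_j:=[0,1/d)+A_j$ is a spectral set with $\Lambda$ as a spectrum.
   Context: For a Lebesgue measurable set $\Omega\subset\mathbb{R}$ of finite positive measure $|\Omega|$ and $\lambda\in\mathbb{R}$, put $e_\lambda(x)=|\Omega|^{-1/2}e^{2\pi i\lambda x}\chi_\Omega(x)$. The pair $(\Omega,\Lambda)$, with $\Lambda\subset\mathbb{R}$, is a spectral pair ($\Omega$ is a spectral set and $\Lambda$ is a spectrum for $\Omega$) if $\{e_\lambda:\lambda\in\Lambda\}$ is an orthonormal basis of $L^2(\Omega)$. A set $\Lambda\subset\mathbb{R}$ is $d$-periodic ($d>0$) if $\Lambda=\{\gamma_1,\dots,\gamma_m\}+d\mathbb{Z}$ for finitely many reals $\gamma_1,\dots,\gamma_m$. Here $\mathbb{Z}/d=\{k/d:k\in\mathbb{Z}\}$ and $E+A=\{x+a:x\in E,\ a\in A\}$.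
   Formalization: The equality of Ω with the union of the sets E_j + A_j is stated up to a Lebesgue null set; literal equality is false, e.g. for Ω = (0,1), Λ = ℤ, d = 1, where 0 lies in some E_j but no integer lies in Ω. *)

(* Defs.v *)
From HB Require Import structures.
From mathcomp Require Import all_boot all_order all_algebra.
From mathcomp Require Import all_classical all_reals all_analysis.
From mathcomp.real_closed Require Import complex.

Set Implicit Arguments.
Unset Strict Implicit.
Unset Printing Implicit Defensive.
Import Order.TTheory GRing.Theory Num.Theory.
Import numFieldNormedType.Exports.
Local Open Scope classical_set_scope.
Local Open Scope ring_scope.

(* The real line carrying the sigma-algebra of Lebesgue measurable sets (the
   Caratheodory completion), as opposed to the Borel sigma-algebra that the
   library puts on R itself.  It is convertible to R. *)
Notation lebesgueR R :=
  (caratheodory_type (wlength (idfun : R -> R))^*%mu).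

Notation leb := completed_lebesgue_measure.

Definition lebesgue_measurable (R : realType) (A : set R) : Prop :=
  measurable (A : set (lebesgueR R)).

(* Elements of L^2(Omega) are represented by functions on the whole line, of
   which only the values on Omega matter; a.e. equality is not quotiented out,
   which affects none of the notions below. *)

Definition sqnormL2 (R : realType) (Omega : set R) (f : R -> R[i]) : \bar R :=
  (\int[leb]_(x in (Omega : set (lebesgueR R))) ((Normc.normc (f x)) ^+ 2)%:E)%E.

Definition inL2 (R : realType) (Omega : set R) (f : R -> R[i]) : Prop :=
  [/\ measurable_fun (Omega : set (lebesgueR R))
        (fun x => complex.Re (f x) : R),
      measurable_fun (Omega : set (lebesgueR R))
        (fun x => complex.Im (f x) : R) &
      (sqnormL2 Omega f < +oo)%E].

Definition complex_integral (R : realType) (Omega : set R) (f : R -> R[i])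
    : R[i] :=
  Complex (\int[leb]_(x in (Omega : set (lebesgueR R))) complex.Re (f x))
          (\int[leb]_(x in (Omega : set (lebesgueR R))) complex.Im (f x)).

Definition innerL2 (R : realType) (Omega : set R) (f g : R -> R[i]) : R[i] :=
  complex_integral Omega (fun x => f x * conjc (g x)).

(* Orthonormal family in L^2(Omega), indexed by Lambda, whose (complex) linear
   span is dense. *)
Definition orthonormal_basisL2 (R : realType) (Omega Lambda : set R)
    (e : R -> R -> R[i]) : Prop :=
  [/\ forall l, Lambda l -> inL2 Omega (e l),
      forall l l', Lambda l -> Lambda l' ->
        innerL2 Omega (e l) (e l') = (l == l')%:R &
      forall f, inL2 Omega f -> forall eps : R, 0 < eps ->
        exists (s : seq R) (c : R -> R[i]),
          (forall l, l \in s -> Lambda l) /\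
          (sqnormL2 Omega (fun x => f x - \sum_(l <- s) c l * e l x)%R
             < (eps ^+ 2)%:E)%E].

Definition expi (R : realType) (t : R) : R[i] := Complex (cos t) (sin t).

Definition e_ (R : realType) (Omega : set R) (l : R) (x : R) : R[i] :=
  real_complex R ((Num.sqrt (fine (leb (Omega : set (lebesgueR R)))))^-1)
    * expi (2 * pi * l * x) * real_complex R (\1_Omega x).

Definition spectral_pair (R : realType) (Omega Lambda : set R) : Prop :=
  [/\ lebesgue_measurable Omega,
      (0 < leb (Omega : set (lebesgueR R)) < +oo)%E &
      orthonormal_basisL2 Omega Lambda (e_ Omega)].

Definition minkowski_sum (R : realType) (E A : set R) : set R :=
  [set x + a | x in E & a in A].

Definition scaledZ (R : realType) (c : R) : set R :=
  [set c * k%:~R | k in [set: int]].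

Definition periodic_set (R : realType) (d : R) (Lambda : set R) : Prop :=
  exists gamma : seq R, Lambda = minkowski_sum [set` gamma] (scaledZ d).

(* Main.v *)
Require Import Defs.
From HB Require Import structures.
From mathcomp Require Import all_boot all_order all_algebra.
From mathcomp Require Import all_classical all_reals all_analysis.
From mathcomp Require Import measurable_realfun.
From mathcomp Require Import ring lra.
From mathcomp.real_closed Require Import complex.

Set Implicit Arguments.
Unset Strict Implicit.
Unset Printing Implicit Defensive.
Import Order.TTheory GRing.Theory Num.Theory.
Import numFieldNormedType.Exports.
Local Open Scope classical_set_scope.
Local Open Scope ring_scope.

(** Let [I] be the period [0, 1/d).  The fiber of [Omega] over [x] in [I], that is
    the set [A(x)] of those [a] in Z/d with [x + a] in [Omega], takes finitely many
    values because [Omega] is bounded; these values, the patterns, define the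
    partition of [I].

    Folding integrals over [Omega] onto [I], the orthogonality of the characters
    of frequencies [l + d k] and [l'] says that all the Fourier coefficients of
    [sum_(a in A(x)) e(l - l')(x + a)] vanish, so that this function is almost
    everywhere zero unless [l = l'] modulo [d], in which case [|A(x)|] is almost
    everywhere equal to [N = d |Omega|].  Hence, on a pattern [S] of positive
    measure, the rows of the matrix [e(g a)] ([g] a representative of [Lambda]
    modulo [d], [a] in [S]) are orthogonal of square norm [N]; by completeness in
    L^2(Omega) its columns are orthogonal too.  A function on [I + S] can thus be
    expanded fiberwise in these characters, and evaluating the same combination on
    the fibers of [Omega] is an isometry onto L^2(Omega) which commutes with
    linear combinations of the exponentials, so density passes from [Omega] to
    [I + S]. *)

(** * Integrals under measure-preserving maps *)

(** The number of representatives of Lambda is not known in advance to be N, so the matrix e(g a) on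
    a pattern is not known to be square, and orthogonality of its rows does not by itself give
    orthogonality of its columns; completeness in L^2(Omega) supplies the missing half. The Gram
    matrix of the rows is the same for every pattern of positive measure, so a combination of
    exponentials of Lambda, even with coefficients depending on x, has the same norm on all such
    fibers: this is the source of the isometry.

    A pattern of measure zero is invisible in L^2(Omega), and nothing can be said of it: its points
    of the period are attached to a pattern of positive measure, and Omega is recovered up to a null
    set.

    Uniqueness of Fourier coefficients is reached through sets rather than kernels: if all
    coefficients of g vanish, so do those of g times the indicator of any measurable set, and the
    mean of that product is the integral of g over the part of the set in the period. Indicators of
    intervals come from arcs of the circle, as limits of polynomials in cosine and sine. *)

Section measure_preserving.
Context d1 d2 (T1 : measurableType d1) (T2 : measurableType d2) (R : realType).
Variables (mu : {measure set T1 -> \bar R}) (nu : {measure set T2 -> \bar R}).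
Variable phi : T1 -> T2.
Hypotheses (mphi : measurable_fun setT phi)
  (muphi : forall A, measurable A -> mu (phi @^-1` A) = nu A).
Variables (D : set T2) (mD : measurable D).

Lemma ge0_integral_preserving (f : T2 -> \bar R) :
    measurable_fun D f -> (forall x, D x -> 0 <= f x)%E ->
  (\int[nu]_(x in D) f x = \int[mu]_(x in phi @^-1` D) f (phi x))%E.
Proof.
move=> mf f0; rewrite -(ge0_integral_pushforward mphi)//; last first.
  by move=> y; rewrite inE => /f0.
by apply: eq_measure_integral => A mA _; exact: (esym (muphi mA)).
Qed.

Lemma integral_preserving (f : T2 -> \bar R) : measurable_fun D f ->
  (\int[nu]_(x in D) f x = \int[mu]_(x in phi @^-1` D) f (phi x))%E.
Proof.
move=> mf; rewrite [LHS]integralE [RHS]integralE.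
congr (_ - _)%E; rewrite ge0_integral_preserving//.
- by apply: eq_integral => x _; rewrite -[LHS]/((f^\+%E \o phi) x) -funepos_comp.
- exact: measurable_funepos.
- by apply: eq_integral => x _; rewrite -[LHS]/((f^\-%E \o phi) x) -funeneg_comp.
- exact: measurable_funeneg.
Qed.

End measure_preserving.

(** * Translation invariance of Lebesgue measure on the completed sigma-algebra *)

Section shift_invariance.
Context {R : realType}.
Implicit Types (t : R) (A : set R).

Let hlength : set (ocitv_type R) -> \bar R := wlength (idfun : R -> R).

Let preimage_shift_ocitv t (X : set R) : ocitv X ->
  ocitv ((fun x => x + t) @^-1` X) /\
  hlength ((fun x => x + t) @^-1` X) = hlength X.
Proof.
move=> -[[a b] _ <-] /=.
have -> : (fun x => x + t) @^-1` `]a, b]%classic = `]a - t, b - t]%classic.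
  by apply/seteqP; split => x /=; rewrite !in_itv/= ltrBlDr lerBrDr.
split; first exact: is_ocitv.
rewrite /hlength !wlength_itv /= !lte_fin ltrD2r -!EFinB.
by case: ifPn => // _; congr (_%:E); rewrite opprB addrA subrK.
Qed.

Let leb_preimage_shift_le t A : (leb ((fun x => (x + t)%R) @^-1` A) <= leb A)%E.
Proof.
apply: le_ereal_inf_tmp => _ /= [F [mF AF]] <-.
apply: ereal_inf_lbound; exists (fun k => (fun x => x + t) @^-1` F k).
  split => [i|x /= /AF[k _ Fk]]; last by exists k.
  by have [] := preimage_shift_ocitv t (mF i).
apply: eq_eseriesr => i _.
by have [_] := preimage_shift_ocitv t (mF i).
Qed.

Let preimage_shiftK t A :
  (fun x => x - t) @^-1` ((fun x => x + t) @^-1` A) = A.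
Proof. by apply/seteqP; split => x /=; rewrite subrK. Qed.

(** Shifting a cover by half-open intervals keeps the lengths, which gives one inequality; the
    opposite shift gives the other. The set is arbitrary, [leb] being computed there as an outer
    measure, and this generality serves for the test sets of the Caratheodory criterion. *)
Lemma leb_preimage_shift t A : leb ((fun x => x + t) @^-1` A) = leb A.
Proof.
apply/eqP; rewrite eq_le leb_preimage_shift_le /=.
by rewrite -{1}(preimage_shiftK t A) leb_preimage_shift_le.
Qed.

(** The Caratheodory criterion at a test set [X] is the criterion for [A] at the translate of [X],
    the outer measure being invariant on all sets. *)
Lemma measurable_preimage_shift t (A : set (lebesgueR R)) : measurable A ->
  measurable ((fun x => x + t) @^-1` A : set (lebesgueR R)).
Proof.
pose mu := (wlength (idfun : R -> R))^*%mu.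
change (caratheodory_measurable mu A ->
  caratheodory_measurable mu ((fun x : R => x + t) @^-1` A)).
move=> mA X.
have -> : X = (fun x => x + t) @^-1` ((fun x => x - t) @^-1` X).
  by apply/seteqP; split => x /=; rewrite addrK.
have e (B : set R) : mu ((fun x => x + t) @^-1` B) = mu B.
  exact: (leb_preimage_shift t B).
set X' := (fun x => x - t) @^-1` X.
have := mA X'; rewrite -(e X') -(e (X' `&` A)) -(e (X' `&` ~` A)).
exact.
Qed.

Lemma measurable_fun_shift t :
  measurable_fun setT ((fun x : R => x + t) : lebesgueR R -> lebesgueR R).
Proof. by move=> _ B mB; rewrite setTI; exact: measurable_preimage_shift. Qed.

Lemma integral_shift t (D : set (lebesgueR R)) (f : R -> \bar R) :
    measurable D -> measurable_fun D (f : lebesgueR R -> \bar R) ->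
  (\int[leb]_(x in D) f x =
   \int[leb]_(x in ((fun x => (x + t)%R) @^-1` D : set (lebesgueR R))) f (x + t)%R)%E.
Proof.
move=> mD mf; apply: (integral_preserving (measurable_fun_shift t) _ mD mf).
by move=> A _; exact: leb_preimage_shift.
Qed.

End shift_invariance.

(** * Borel sets and bounded measurable functions *)

Section borel.
Context {R : realType}.

Lemma borel_lebesgue (A : set R) : measurable A ->
  measurable (A : set (lebesgueR R)).
Proof. exact: sub_caratheodory. Qed.

Lemma borel_fun_lebesgue (D : set (lebesgueR R)) d (T : measurableType d) (f : R -> T) :
  measurable_fun setT f -> measurable_fun D f.
Proof.
move=> mf mD B mB; apply: (measurableI _ _ mD).
have := mf measurableT B mB; rewrite setTI; exact: borel_lebesgue.
Qed.

(** The identity, from the completed sigma-algebra to the Borel one, preserves measure. This gives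
    access to the fundamental theorem of calculus, stated for the Borel measure. *)
Lemma leb_integral_borel (D : set R) (f : R -> \bar R) :
    measurable D -> measurable_fun D f ->
  (\int[leb]_(x in (D : set (lebesgueR R))) f x =
   \int[lebesgue_measure]_(x in D) f x)%E.
Proof.
move=> mD mf.
have mid : measurable_fun setT (idfun : lebesgueR R -> R).
  exact: (borel_fun_lebesgue (@measurable_id _ R setT)).
apply: esym.
exact: (@integral_preserving _ _ (lebesgueR R) (measurableTypeR R) R leb
  lebesgue_measure idfun mid (fun _ _ => erefl) D mD f mf).
Qed.

End borel.

Section bounded_measurable.
Context {R : realType}.
Implicit Types (D : set (lebesgueR R)) (f g : R -> R).

(** Carrying the bound along makes the class stable under products, and makes each member integrable
    on a set of finite measure. *)
Definition bddmeas D f :=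
  measurable_fun D (f : lebesgueR R -> R) /\
  exists C, forall x, D x -> `|f x| <= C.

Lemma bddmeas_cst D c : bddmeas D (fun=> c).
Proof. by split; [exact: measurable_cst|exists `|c|]. Qed.

Lemma bddmeasD D f g : bddmeas D f -> bddmeas D g ->
  bddmeas D (fun x => f x + g x).
Proof.
move=> [mf [C fC]] [mg [C' gC']]; split; first exact: measurable_funD.
by exists (C + C') => x Dx; rewrite (le_trans (ler_normD _ _))// lerD ?fC ?gC'.
Qed.

Lemma bddmeasM D f g : bddmeas D f -> bddmeas D g ->
  bddmeas D (fun x => f x * g x).
Proof.
move=> [mf [C fC]] [mg [C' gC']]; split; first exact: measurable_funM.
by exists (C * C') => x Dx; rewrite normrM ler_pM ?fC ?gC'.
Qed.

Lemma bddmeas_sum (I : Type) (s : seq I) (P : pred I) D (F : I -> R -> R) :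
  (forall i, P i -> bddmeas D (F i)) ->
  bddmeas D (fun x => \sum_(i <- s | P i) F i x).
Proof.
move=> bF; elim: s => [|i s ih].
  by under eq_fun do rewrite big_nil; exact: bddmeas_cst.
have [Pi|/negPf nPi] := boolP (P i); last by under eq_fun do rewrite big_cons nPi.
by under eq_fun do rewrite big_cons Pi; apply: bddmeasD => //; exact: bF.
Qed.

Lemma bddmeas_eq D f g : {in D, f =1 g} -> bddmeas D f -> bddmeas D g.
Proof.
move=> fg [mf [C fC]]; split; first
  exact: (@eq_measurable_fun _ _ (lebesgueR R) R D f g fg mf).
by exists C => x Dx; rewrite -fg ?inE// fC.
Qed.

Lemma bddmeas_cos D w : bddmeas D (fun x => cos (w * x)).
Proof.
split; last by exists 1 => x _; exact: cos_max.
apply: borel_fun_lebesgue; apply: continuous_measurable_fun => x.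
apply: continuous_comp; last exact: continuous_cos.
by apply: continuousM; [exact: cst_continuous|].
Qed.

Lemma bddmeas_sin D w : bddmeas D (fun x => sin (w * x)).
Proof.
split; last by exists 1 => x _; exact: sin_max.
apply: borel_fun_lebesgue; apply: continuous_measurable_fun => x.
apply: continuous_comp; last exact: continuous_sin.
by apply: continuousM; [exact: cst_continuous|].
Qed.

Lemma bddmeas_integrable D f : measurable D -> (leb D < +oo)%E ->
  bddmeas D f -> (@leb R).-integrable D (EFin \o f).
Proof.
move=> mD Doo [mf [C fC]]; apply: measurable_bounded_integrable => //.
exists C; split; first exact: num_real.
by move=> M CM x Dx; apply: (le_trans (fC _ Dx)); exact: ltW.
Qed.

End bounded_measurable.

(** * Polynomials converging to a step on [0, 1] *)

Section threshold.
Context {R : realType}.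

Lemma bernoulli_ge (x : R) n : -1 <= x -> 1 + n%:R * x <= (1 + x) ^+ n.
Proof.
move=> x1; have x1' : 0 <= 1 + x by lra.
elim: n => [|n ih]; first by rewrite mul0r addr0 expr0.
rewrite exprS; apply: le_trans (ler_wpM2l x1' ih).
rewrite -natr1 -subr_ge0.
have -> : (1 + x) * (1 + n%:R * x) - (1 + (n%:R + 1) * x) = n%:R * x ^+ 2 by ring.
by rewrite mulr_ge0 ?ler0n// sqr_ge0.
Qed.

(** With [r = s * s], one factor [s ^+ n] absorbs [n], since n s^n is at most 1 / (1 - s), and the
    other still tends to 0. *)
Lemma natr_expr_cvg0 (r : R) : 0 <= r < 1 -> (n%:R * r ^+ n) @[n --> \oo] --> 0.
Proof.
move=> /andP[r0 r1].
pose s := Num.sqrt r.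
have s0 : 0 <= s by exact: sqrtr_ge0.
have s1 : s < 1 by rewrite -sqrtr1 ltr_sqrt.
have rE : r = s * s by rewrite -expr2 sqr_sqrtr.
have h n : (n%:R * (1 - s) + 1) * s ^+ n <= 1.
  elim: n => [|n ih]; first by rewrite mul0r add0r mul1r expr0.
  have sn : s ^+ n.+1 <= 1 by rewrite exprn_ile1// ltW.
  have e : (n.+1%:R * (1 - s) + 1) * s ^+ n.+1 =
    s * ((n%:R * (1 - s) + 1) * s ^+ n) + (1 - s) * s ^+ n.+1.
    by rewrite -natr1 exprS; ring.
  rewrite e (@le_trans _ _ (s * 1 + (1 - s) * 1))//; last by lra.
  by apply: lerD; apply: ler_wpM2l => //; lra.
apply: (@squeeze_cvgr _ _ _ _ (cst 0) (fun n => (1 - s)^-1 * s ^+ n)).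
- apply: nearW => n; rewrite mulr_ge0 ?ler0n ?exprn_ge0//=.
  rewrite rE exprMn mulrA ler_wpM2r ?exprn_ge0//.
  rewrite -[leRHS]mul1r ler_pdivlMr ?subr_gt0//.
  apply: le_trans (h n); rewrite mulrAC ler_wpM2r ?exprn_ge0//.
  by rewrite lerDl.
- exact: cvg_cst.
- rewrite -[X in _ --> X](mulr0 (1 - s)^-1); apply: cvgMr.
  by apply: cvg_expr; rewrite ger0_norm.
Qed.

(* The exponent [n 2^n], rather than [2^n], makes the sequence converge at the
   threshold [w = 1/2] too. *)
Definition soft_step (w : R) n : R := (1 - w ^+ n) ^+ (n * 2 ^ n).

Lemma soft_step_itv w n : 0 <= w <= 1 -> 0 <= soft_step w n <= 1.
Proof.
move=> /andP[w0 w1]; have /andP[h0 h1] : 0 <= w ^+ n <= 1.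
  by rewrite exprn_ge0//= exprn_ile1.
by rewrite exprn_ge0 ?subr_ge0//= exprn_ile1// ?subr_ge0// gerBl.
Qed.

(** Below 1/2, Bernoulli's inequality bounds the sequence from below by 1 - n (2w)^n. From 1/2 on,
    its product with (1 + w^n)^(n 2^n) is at most 1, and that factor is at least n + 1, again by
    Bernoulli. *)
Lemma cvg_soft_step (w : R) : 0 <= w <= 1 ->
  (soft_step w n) @[n --> \oo] --> ((w < 2^-1)%R%:R : R).
Proof.
move=> /andP[w0 w1]; have wn n : 0 <= w ^+ n <= 1.
  by rewrite exprn_ge0//= exprn_ile1.
have [w2|w2] := ltP w 2^-1.
  apply: (@squeeze_cvgr _ _ _ _ (fun n => 1 - n%:R * (2 * w) ^+ n) (cst 1)).
  - apply: nearW => n; apply/andP; split; last first.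
      by have /andP[] := @soft_step_itv w n (introT andP (conj w0 w1)).
    have := @bernoulli_ge (- w ^+ n) (n * 2 ^ n).
    rewrite lerNr opprK; have /andP[_ ->] := wn n => /(_ isT).
    apply: le_trans; rewrite mulrN lerD2l lerN2 exprMn natrM natrX mulrA.
    by [].
  - rewrite -[X in _ --> X]subr0; apply: cvgB; first exact: cvg_cst.
    by apply: natr_expr_cvg0; lra.
  - exact: cvg_cst.
apply: (@squeeze_cvgr _ _ _ _ (cst 0) (fun n => n.+1%:R^-1)).
- apply: nearW => n; apply/andP; split.
    by have /andP[] := @soft_step_itv w n (introT andP (conj w0 w1)).
  have /andP[wn0 wn1] := wn n.
  have h : (1 - w ^+ n) ^+ (n * 2 ^ n) * (1 + w ^+ n) ^+ (n * 2 ^ n) <= 1.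
    rewrite -exprMn -subr_sqr expr1n exprn_ile1//.
      by rewrite subr_ge0 exprn_ile1// ?exprn_ge0.
    by rewrite gerBl exprn_ge0.
  have h2 : n.+1%:R <= (1 + w ^+ n) ^+ (n * 2 ^ n).
    apply: le_trans (@bernoulli_ge _ _ _); last by lra.
    rewrite -natr1 addrC lerD2l natrM -mulrA ler_peMr//.
    rewrite natrX -exprMn exprn_ege1//; lra.
  rewrite -[leRHS]mul1r ler_pdivlMr ?ltr0n//.
  apply: le_trans h; apply: ler_wpM2l => //.
  by have /andP[] := @soft_step_itv w n (introT andP (conj w0 w1)).
- exact: cvg_cst.
- exact: cvg_harmonic.
Qed.

End threshold.

(** * Uniqueness of Fourier coefficients *)

Lemma mem_set_itv (R : realType) (i : interval R) (x : R) :
  (x \in [set` i]) = (x \in i).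
Proof. by apply/idP/idP => [/set_mem//|xi]; exact/mem_set. Qed.

Section fourier_uniqueness.
Context {R : realType} (d : R).
Hypothesis d_gt0 : 0 < d.
Implicit Types (f g phi psi : R -> R).

Let I : set (lebesgueR R) := `[0, d^-1[%classic.

Let mI : measurable I.
Proof. exact: (borel_lebesgue (measurable_itv _)). Qed.

Lemma leb_period : leb (`[0, d^-1[%classic : set R) = (d^-1)%:E.
Proof.
have := lebesgue_measure_itv `[0, d^-1[; rewrite /= lte_fin invr_gt0 d_gt0.
by rewrite sube0; exact.
Qed.

Let Ioo : (leb I < +oo)%E.
Proof. by rewrite leb_period ltry. Qed.

Let integrableI f : bddmeas I f -> (@leb R).-integrable I (EFin \o f).
Proof. exact: bddmeas_integrable. Qed.

Definition mean_zero f :=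
  bddmeas I f /\ (\int[leb]_(x in I) (f x)%:E = 0)%E.

Let mean_zero_eq f g : (forall x, I x -> f x = g x) ->
  mean_zero f -> mean_zero g.
Proof.
move=> fg [bf f0]; have fg' : {in I, f =1 g} by move=> x; rewrite inE => /fg.
split; first exact: (bddmeas_eq fg').
by rewrite -f0; apply: eq_integral => x xI; rewrite fg'.
Qed.

Let mean_zero_lin a b f g : mean_zero f -> mean_zero g ->
  mean_zero (fun x => a * f x + b * g x).
Proof.
move=> [bf f0] [bg g0].
have baf := bddmeasM (bddmeas_cst I a) bf.
have bbg := bddmeasM (bddmeas_cst I b) bg.
split; first exact: bddmeasD.
have := integralD_EFin mI (integrableI baf) (integrableI bbg).
move=> /= ->.
have := integralZl mI (integrableI bf) a; rewrite /= f0 mule0 => ->.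
by have := integralZl mI (integrableI bg) b; rewrite /= g0 mule0 => ->; rewrite adde0.
Qed.

Let bddmeas_lim (h : nat -> R -> R) f C :
  (forall n, bddmeas I (h n)) -> (forall n x, I x -> `|h n x| <= C) ->
  (forall x, I x -> h n x @[n --> \oo] --> f x) -> bddmeas I f.
Proof.
move=> bh hC hf; split.
  by apply: (@measurable_fun_cvg _ (lebesgueR R) R I h f) => // n; have [] := bh n.
exists C => x Ix; have /cvg_norm/cvgr_to_le := hf x Ix; apply.
by apply: nearW => n; exact: hC.
Qed.

Let mean_zero_lim (h : nat -> R -> R) f C :
  (forall n, mean_zero (h n)) -> (forall n x, I x -> `|h n x| <= C) ->
  (forall x, I x -> h n x @[n --> \oo] --> f x) -> mean_zero f.
Proof.
move=> h0 hC hf.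
have bf : bddmeas I f by apply: (bddmeas_lim _ hC hf) => n; have [] := h0 n.
split => //.
have [|||||_ _] := @dominated_convergence _ (lebesgueR R) R leb I mI
  (fun n => EFin \o h n) (EFin \o f) (cst C%:E).
- by move=> n; have [[mh _] _] := h0 n; exact/measurable_EFinP.
- by have [mf _] := bf; exact/measurable_EFinP.
- by apply: aeW => x Ix; apply: cvg_EFin; [exact: nearW|exact: hf].
- exact: (integrableI (bddmeas_cst I C)).
- by apply: aeW => x n Ix /=; rewrite lee_fin hC.
have -> : (fun n => \int[leb]_(x in I) (EFin \o h n) x)%E = cst 0%E.
  by apply/funext => n; have [_] := h0 n.
by move=> /cvg_lim; rewrite lim_cst// => <-.
Qed.

(** Vanishing of all complex Fourier coefficients at the frequencies in d Z, in real form. Letting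
    [k] run over [int] makes multiplication by a cosine or a sine a plain shift to [k + 1] and
    [k - 1]. *)
Definition fourier_null g := bddmeas I g /\
  forall k : int,
    mean_zero (fun x => g x * cos (2 * pi * d * k%:~R * x)) /\
    mean_zero (fun x => g x * sin (2 * pi * d * k%:~R * x)).

(* Multipliers form an algebra closed under bounded pointwise limits, so the
   sets whose indicator is a multiplier form a sigma-algebra. *)
Definition multiplier phi := bddmeas I phi /\
  forall g, fourier_null g -> fourier_null (fun x => g x * phi x).

Let fourier_null_eq f g : (forall x, I x -> f x = g x) ->
  fourier_null f -> fourier_null g.
Proof.
move=> fg [bf f0]; split.
  by apply: bddmeas_eq bf => x; rewrite inE => /fg.
by move=> k; have [c s] := f0 k; split;
  [apply: mean_zero_eq c|apply: mean_zero_eq s] => x Ix; rewrite fg.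
Qed.

Let fourier_null_lin a b f g : fourier_null f -> fourier_null g ->
  fourier_null (fun x => a * f x + b * g x).
Proof.
move=> [bf f0] [bg g0]; split.
  by apply: bddmeasD; apply: (bddmeasM (bddmeas_cst _ _)).
move=> k; have [fc fs] := f0 k; have [gc gs] := g0 k; split.
  by apply: mean_zero_eq (mean_zero_lin a b fc gc) => x _ /=; ring.
by apply: mean_zero_eq (mean_zero_lin a b fs gs) => x _ /=; ring.
Qed.

Let multiplier_eq phi psi : (forall x, I x -> phi x = psi x) ->
  multiplier phi -> multiplier psi.
Proof.
move=> e [bphi mphi]; split.
  by apply: bddmeas_eq bphi => x; rewrite inE => /e.
by move=> g /mphi; apply: fourier_null_eq => x Ix; rewrite e.
Qed.

Let multiplier_lin a b phi psi : multiplier phi -> multiplier psi ->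
  multiplier (fun x => a * phi x + b * psi x).
Proof.
move=> [bp mp] [bq mq]; split.
  by apply: bddmeasD; apply: (bddmeasM (bddmeas_cst _ _)).
move=> g g0; apply: fourier_null_eq (fourier_null_lin a b (mp _ g0) (mq _ g0)).
by move=> x _ /=; ring.
Qed.

Let multiplier_mul phi psi : multiplier phi -> multiplier psi ->
  multiplier (fun x => phi x * psi x).
Proof.
move=> [bp mp] [bq mq]; split; first exact: bddmeasM.
by move=> g /mp/mq; apply: fourier_null_eq => x _; rewrite mulrA.
Qed.

Let multiplier1 : multiplier (fun=> 1).
Proof.
split; first exact: bddmeas_cst.
by move=> g; apply: fourier_null_eq => x _; rewrite mulr1.
Qed.

Let multiplier_cst c : multiplier (fun=> c).
Proof.
apply: multiplier_eq (multiplier_lin c 0 multiplier1 multiplier1) => x _.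
by rewrite mulr1 mul0r addr0.
Qed.

Let multiplier_exp phi n : multiplier phi -> multiplier (fun x => phi x ^+ n).
Proof.
move=> mp; elim: n => [|n ih]; first by apply: multiplier_eq multiplier1.
by apply: multiplier_eq (multiplier_mul mp ih) => x _; rewrite exprS.
Qed.

Let multiplier_lim (h : nat -> R -> R) f C :
  (forall n, multiplier (h n)) -> (forall n x, I x -> `|h n x| <= C) ->
  (forall x, I x -> h n x @[n --> \oo] --> f x) -> multiplier f.
Proof.
move=> mh hC hf; split.
  by apply: (bddmeas_lim _ hC hf) => n; have [] := mh n.
move=> g g0; have [[mg [M gM]] _] := g0.
have ghM n x : I x -> `|g x * h n x| <= M * C.
  by move=> Ix; rewrite normrM ler_pM ?gM ?hC.
have gh x : I x -> g x * h n x @[n --> \oo] --> g x * f x.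
  by move=> Ix; apply: cvgMr; exact: hf.
have gh0 n : fourier_null (fun x => g x * h n x) by exact: ((mh n).2 g g0).
split.
  by apply: (bddmeas_lim _ ghM gh) => n; have [] := gh0 n.
have aux (t : R -> R) : (forall x, `|t x| <= 1) ->
    (forall n, mean_zero (fun x => g x * h n x * t x)) ->
    mean_zero (fun x => g x * f x * t x).
  move=> t1 ht; apply: (@mean_zero_lim (fun n x => g x * h n x * t x) _ (M * C)) => //.
    move=> n x Ix; rewrite normrM -[leRHS]mulr1 ler_pM ?ghM//.
  by move=> x Ix; apply: cvgMl; exact: gh.
move=> k; split; apply: aux => [x|n].
- exact: cos_max.
- by have [_ /(_ k)[]] := gh0 n.
- exact: sin_max.
- by have [_ /(_ k)[]] := gh0 n.
Qed.

Let w1 := 2 * pi * d.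

Let cosDk k x : cos (w1 * (k + 1)%:~R * x) =
  cos (w1 * k%:~R * x) * cos (w1 * x) - sin (w1 * k%:~R * x) * sin (w1 * x).
Proof. by rewrite -cosD intrD; congr cos; ring. Qed.

Let cosBk k x : cos (w1 * (k - 1)%:~R * x) =
  cos (w1 * k%:~R * x) * cos (w1 * x) + sin (w1 * k%:~R * x) * sin (w1 * x).
Proof. by rewrite -cosB intrB; congr cos; ring. Qed.

Let sinDk k x : sin (w1 * (k + 1)%:~R * x) =
  sin (w1 * k%:~R * x) * cos (w1 * x) + cos (w1 * k%:~R * x) * sin (w1 * x).
Proof. by rewrite -sinD intrD; congr sin; ring. Qed.

Let sinBk k x : sin (w1 * (k - 1)%:~R * x) =
  sin (w1 * k%:~R * x) * cos (w1 * x) - cos (w1 * k%:~R * x) * sin (w1 * x).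
Proof. by rewrite -sinB intrB; congr sin; ring. Qed.

(** By the product-to-sum formulas, a coefficient of [g * cos] is an average of the coefficients of
    [g] at the two neighbouring indices. *)
Let multiplier_cos : multiplier (fun x => cos (w1 * x)).
Proof.
split; first exact: bddmeas_cos.
move=> g [bg g0]; split; first exact: (bddmeasM bg (bddmeas_cos _ _)).
move=> k; have [cD sD] := g0 (k + 1); have [cB sB] := g0 (k - 1); split.
  apply: mean_zero_eq (mean_zero_lin 2^-1 2^-1 cD cB) => x _.
  by rewrite cosDk cosBk; field.
apply: mean_zero_eq (mean_zero_lin 2^-1 2^-1 sD sB) => x _.
by rewrite sinDk sinBk; field.
Qed.

Let multiplier_sin : multiplier (fun x => sin (w1 * x)).
Proof.
split; first exact: bddmeas_sin.
move=> g [bg g0]; split; first exact: (bddmeasM bg (bddmeas_sin _ _)).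
move=> k; have [cD sD] := g0 (k + 1); have [cB sB] := g0 (k - 1); split.
  apply: mean_zero_eq (mean_zero_lin 2^-1 (- 2^-1) sD sB) => x _.
  by rewrite sinDk sinBk; field.
apply: mean_zero_eq (mean_zero_lin 2^-1 (- 2^-1) cB cD) => x _.
by rewrite cosDk cosBk; field.
Qed.

(** The indicator of an arc is the bounded pointwise limit of [soft_step] applied to an affine
    function of cosine and sine, and each term is a polynomial in these two multipliers. *)
Let multiplier_cap (a : R) :
  multiplier (fun x => (cos a < cos (w1 * x - a))%R%:R).
Proof.
(* The difference of cosines ranges over [-2, 2]: the factor 1/4 brings [w] into [0, 1], and the cap
   becomes the set where [w] is below 1/2, the threshold of [soft_step]. *)
pose w x := 2^-1 + (cos a - cos (w1 * x - a)) / 4.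
have w01 x : 0 <= w x <= 1.
  rewrite /w; have := cos_geN1 a; have := cos_le1 a.
  have := cos_geN1 (w1 * x - a); have := cos_le1 (w1 * x - a).
  by move=> *; apply/andP; split; lra.
have mw : multiplier w.
  have h1 := multiplier_lin (- (cos a / 4)) (- (sin a / 4))
    multiplier_cos multiplier_sin.
  apply: multiplier_eq (multiplier_lin 1 (2^-1 + cos a / 4) h1 multiplier1) => x _.
  by rewrite /w cosB; field.
apply: (@multiplier_lim (fun n x => soft_step (w x) n) _ 1).
- move=> n; apply: multiplier_exp.
  apply: multiplier_eq (multiplier_lin 1 (-1) multiplier1 (multiplier_exp n mw)).
  by move=> x _; rewrite mulr1 mulN1r.
- by move=> n x _; have /andP[s0 s1] := soft_step_itv n (w01 x); rewrite ger0_norm.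
- move=> x _; have := cvg_soft_step (w01 x).
  suff -> : (w x < 2^-1) = (cos a < cos (w1 * x - a)) by [].
  by rewrite /w; apply/idP/idP => ?; lra.
Qed.

Let cos_cap (a t : R) : 0 < a < pi -> - a <= t < 2 * pi - a ->
  (cos a < cos t) = (`|t| < a).
Proof.
move=> /andP[a0 ap] /andP[t1 t2].
have aI : a \in `[0, pi] by rewrite in_itv/=; apply/andP; split; exact: ltW.
have [tp|tp] := leP `|t| pi.
  by rewrite -(cos_norm t) ltr_cos// in_itv/= normr_ge0.
have t0 : 0 <= t.
  by rewrite leNgt; apply/negP => t0; move: tp; rewrite ltr0_norm//; lra.
rewrite ger0_norm// in tp *.
(* Past pi both sides are false: [2 * pi - t] lies in [0, pi] and exceeds [a], because the window
   stops at [2 * pi - a]. *)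
have -> : cos t = cos (2 * pi - t).
  rewrite -(cosN t) -(cosD2pi (- t)); congr cos; rewrite -mulr_natl; ring.
rewrite ltr_cos//; last by rewrite in_itv/=; apply/andP; split; lra.
by apply/idP/idP => ?; lra.
Qed.

(* On the period, the cap of the circle centred at the angle [pi d y] and of
   half-width [pi d y] is the interval ]0, y[. *)
Let multiplier_itv y : 0 < y < d^-1 -> multiplier \1_`]0, y[.
Proof.
move=> /andP[y0 yd]; have dy : d * y < 1 by rewrite -ltr_pdivlMl ?mulr1.
have pd : 0 < pi * d by rewrite mulr_gt0// pi_gt0.
apply: multiplier_eq (multiplier_cap (pi * d * y)) => x.
rewrite /I/= in_itv/= => /andP[x0 xd].
have dx : d * x < 1 by rewrite -ltr_pdivlMl ?mulr1.
have -> : w1 * x - pi * d * y = pi * d * (2 * x - y) by rewrite /w1; ring.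
have p0 := pi_gt0 R.
have h1 : 0 < pi * d * y < pi by rewrite mulr_gt0//= -mulrA gtr_pMr.
have h2 : - (pi * d * y) <= pi * d * (2 * x - y) < 2 * pi - pi * d * y.
  have : 0 <= pi * d * x by rewrite mulr_ge0// ltW.
  by move=> ?; apply/andP; split; nra.
rewrite (cos_cap h1 h2) normrM gtr0_norm// ltr_pM2l// indicE.
congr (nat_of_bool _)%:R; rewrite mem_set_itv in_itv/= ltr_norml.
by apply/idP/idP => /andP[? ?]; apply/andP; split; lra.
Qed.

(** Null sets bring in the single point 0 of the period, which no open arc isolates, and the passage
    from Borel to Lebesgue measurable sets. *)
Let multiplier_null (N : set (lebesgueR R)) : measurable N -> leb N = 0%E ->
  multiplier \1_N.
Proof.
move=> mN N0.
have b1 : bddmeas I \1_N.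
  split; first by apply: (measurable_indic mN).
  by exists 1 => x _; rewrite indicE; case: (_ \in _); rewrite /= ?normr1 ?normr0.
split; first exact: b1.
move=> g [bg g0].
have bgN : bddmeas I (fun x => g x * \1_N x) by exact: bddmeasM.
have aux f : bddmeas I f -> mean_zero (fun x => g x * \1_N x * f x).
  move=> bf; have b2 := bddmeasM bgN bf; split; first exact: b2.
  have := negligible_integral mN mI (integrableI b2) N0.
  move=> /= ->; apply: integral0_eq => x [_ /= nNx].
  by rewrite indicE memNset// mulr0 mul0r.
split; first exact: bgN.
move=> k; split; apply: aux; [exact: bddmeas_cos|exact: bddmeas_sin].
Qed.

Let mset : set (set R) := [set A | multiplier \1_A].

Let mset_setC A : mset A -> mset (~` A).
Proof.
move=> mA; apply: multiplier_eq (multiplier_lin 1 (-1) multiplier1 mA) => x _.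
by rewrite mulr1 mulN1r !indicE in_setC; case: (x \in A); rewrite /= ?subr0 ?subrr.
Qed.

Let mset_setU A B : mset A -> mset B -> mset (A `|` B).
Proof.
move=> mA mB; have h := multiplier_lin 1 1 mA mB.
apply: multiplier_eq (multiplier_lin 1 (-1) h (multiplier_mul mA mB)) => x _.
rewrite !indicE in_setU; case: (x \in A); case: (x \in B) => /=; lra.
Qed.

Let sigma_algebra_mset : sigma_algebra setT mset.
Proof.
split.
- by apply: multiplier_eq (multiplier_cst 0) => x _; rewrite indicE in_set0.
- by move=> A mA; rewrite setTD; exact: mset_setC.
- move=> A mA.
  have mU n : mset (\big[setU/set0]_(i < n) A i).
    elim: n => [|n ih]; last by rewrite big_ord_recr; exact: mset_setU.
    rewrite big_ord0.
    by apply: multiplier_eq (multiplier_cst 0) => x _; rewrite indicE in_set0.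
  apply: (@multiplier_lim (fun n => \1_(\big[setU/set0]_(i < n) A i)) _ 1) => //.
    by move=> n x _; rewrite indicE; case: (_ \in _); rewrite /= ?normr1 ?normr0.
  move=> x _; have [[k _ Akx]|nAx] := pselect ((\bigcup_k A k) x).
    have -> : \1_(\bigcup_k A k) x = 1 :> R by rewrite indicE mem_set//; exists k.
    apply: cvg_near_cst; exists k.+1 => // n /= kn.
    rewrite indicE mem_set// -bigcup_mkord; exists k => //.
  have -> : \1_(\bigcup_k A k) x = 0 :> R by rewrite indicE memNset.
  apply: cvg_near_cst; apply: nearW => n.
  rewrite indicE memNset// -bigcup_mkord => -[i _ Aix]; apply: nAx.
  by exists i.
Qed.

Let mset_null (N : set R) : (@lebesgue_measure R).-negligible N -> mset N.
Proof.
move=> [M [mM M0 NM]].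
have lM := borel_lebesgue mM.
have lN : measurable (N : set (lebesgueR R)).
  by apply: completed_lebesgue_measure_is_complete; exists M; split.
apply: (multiplier_null lN).
exact: (@subset_measure0 _ (lebesgueR R) R leb N M lN lM NM).
Qed.

(** The rays ]-oo, y[ generate the Borel sets, and their trace on the period is empty, full, or the
    union of the null set {0} and ]0, y[. *)
Let borel_mset (A : set R) : measurable A -> mset A.
Proof.
have -> : (measurable : set (set R)) = <<s (@RGenInftyO.G R) >>.
  exact: RGenInftyO.measurableE.
apply: smallest_sub; first exact: sigma_algebra_mset.
move=> _ [y ->].
have [y0|y0] := leP y 0.
  apply: multiplier_eq (multiplier_cst 0) => x.
  rewrite /I/= in_itv/= => /andP[x0 _]; rewrite indicE memNset//= in_itv/=.
  by apply/negP; rewrite -leNgt (le_trans y0).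
have [yd|yd] := leP d^-1 y.
  apply: multiplier_eq multiplier1 => x.
  rewrite /I/= in_itv/= => /andP[_ xd]; rewrite indicE mem_set//= in_itv/=.
  exact: (lt_le_trans xd).
have m0 : mset [set 0].
  by apply: mset_null; exists [set 0]; split => //; exact: lebesgue_measure_set1.
have my : mset `]0, y[%classic by apply: multiplier_itv; rewrite y0 yd.
apply: multiplier_eq (mset_setU m0 my) => x.
rewrite /I/= in_itv/= => /andP[x0 _]; rewrite !indicE; congr (nat_of_bool _)%:R.
rewrite in_setU !mem_set_itv !in_itv/= (_ : (x \in [set 0]) = (x == 0)).
  by have [->|xn0] := eqVneq x 0; rewrite ?y0// lt_neqAle eq_sym xn0 x0.
by apply/idP/eqP => [/set_mem//|->]; exact/mem_set.
Qed.

Let lebesgue_mset (A : set (lebesgueR R)) : measurable A -> mset A.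
Proof.
have -> : (measurable : set (set (lebesgueR R))) =
    completed_algebra_gen (@lebesgue_measure R).
  by rewrite -g_sigma_completed_algebra_genE completed_caratheodory_measurable.
move=> [B mB [N negN <-]]; apply: mset_setU; first exact: borel_mset.
exact: mset_null.
Qed.

(** As indicators of measurable sets are multipliers, the coefficient of index 0 of [g * \1_E]
    vanishes, that is, [g] has integral 0 over every measurable part [E] of the period. *)
Lemma fourier_null_ae0 g : fourier_null g ->
  {ae leb, forall x, `[0, d^-1[%classic x -> g x = 0}.
Proof.
move=> g0; have [bg _] := g0.
have := @integral_ae_eq _ (lebesgueR R) R leb I mI (cst 0%E) (EFin \o g)
  (integrableI bg) (measurable_cst _).
have h E : E `<=` I -> measurable E ->
    (\int[leb]_(x in E) (EFin \o g) x = \int[leb]_(x in E) cst 0 x)%E.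
  move=> EI mE; rewrite integral0.
  have [_ /(_ g g0)[_ /(_ 0)[[_ +] _]]] := lebesgue_mset mE.
  have IE : I `&` E = E by rewrite setIC; exact/setIidl.
  move=> <-; rewrite -[in LHS]IE integral_mkcondr; apply: eq_integral => x _.
  rewrite mulr0 mul0r cos0 mulr1 indicE /patch /=.
  by case: (x \in E); rewrite ?mulr1 ?mulr0.
move=> /(_ h); apply: filterS => x /= h' Ix.
by have := h' Ix; case.
Qed.

End fourier_uniqueness.

(** * Folding integrals onto a period *)

Lemma is_derive_sin_scaled (R : realType) (w x : R) : w != 0 ->
  is_derive x 1 (fun y => w^-1 * sin (w * y)) (cos (w * x)).
Proof.
move=> w0.
have h : is_derive x 1 (fun y => w * y) w.
  have h1 := is_deriveZ w (is_derive_id x (1 : R)).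
  by apply: is_derive_eq h1 _; rewrite /GRing.scale/= mulr1.
have h2 : is_derive x 1 (fun y => sin (w * y)) (cos (w * x) * w).
  exact: (@is_derive1_comp _ sin (fun y => w * y)).
have h3 := is_deriveZ w^-1 h2.
by apply: is_derive_eq h3 _; rewrite /GRing.scale/= mulrC mulfK.
Qed.

Lemma is_derive_cos_scaled (R : realType) (w x : R) : w != 0 ->
  is_derive x 1 (fun y => - w^-1 * cos (w * y)) (sin (w * x)).
Proof.
move=> w0.
have h : is_derive x 1 (fun y => w * y) w.
  have h1 := is_deriveZ w (is_derive_id x (1 : R)).
  by apply: is_derive_eq h1 _; rewrite /GRing.scale/= mulr1.
have h2 : is_derive x 1 (fun y => cos (w * y)) (- sin (w * x) * w).
  exact: (@is_derive1_comp _ cos (fun y => w * y)).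
have h3 := is_deriveZ (- w^-1) h2.
by apply: is_derive_eq h3 _; rewrite /GRing.scale/=; field.
Qed.

Lemma integral_derive_period (R : realType) (b : R) (f F : R -> R) : 0 < b ->
  continuous f -> (forall x : R, is_derive x 1 F (f x)) -> F b = F 0 ->
  (\int[leb]_(x in (`[0%R, b[%classic : set (lebesgueR R))) (f x)%:E = 0)%E.
Proof.
move=> b0 cf dF Fb.
have mf D : measurable_fun D (EFin \o f).
  by apply/measurable_EFinP; apply: measurable_funTS; exact: continuous_measurable_fun.
rewrite leb_integral_borel//.
rewrite integral_itv_bndo_bndc//.
have cF : continuous F.
  by move=> x; apply/differentiable_continuous/derivable1_diffP; have [] := dF x.
rewrite (@continuous_FTC2 _ f F)//.
- by rewrite Fb subee.
- exact: continuous_subspaceT.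
- split.
  + by move=> x _; have [] := dF x.
  + exact/cvg_at_right_filter/cF.
  + exact/cvg_at_left_filter/cF.
- by move=> x _; rewrite derive1E; have [_ ->] := dF x.
Qed.

Lemma cosDz2pi (R : realType) (x : R) (m : int) : cos (x + 2 * pi * m%:~R) = cos x.
Proof.
have h (y : R) (n : nat) : cos (y + 2 * pi * n%:R) = cos y.
  rewrite -(periodicn (@cosD2pi R) n y); congr cos.
  by rewrite -mulr_natl -mulr_natr; ring.
case: m => n; first exact: h.
rewrite NegzE intrN -(h _ n.+1); congr cos; rewrite -pmulrn; ring.
Qed.

Lemma sinDz2pi (R : realType) (x : R) (m : int) : sin (x + 2 * pi * m%:~R) = sin x.
Proof.
have h (y : R) (n : nat) : sin (y + 2 * pi * n%:R) = sin y.
  rewrite -(periodicn (@sinD2pi R) n y); congr sin.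
  by rewrite -mulr_natl -mulr_natr; ring.
case: m => n; first exact: h.
rewrite NegzE intrN -(h _ n.+1); congr sin; rewrite -pmulrn; ring.
Qed.

Lemma integral_cos_period (R : realType) (d : R) (k : int) : 0 < d -> k != 0 ->
  (\int[leb]_(x in (`[0%R, (d^-1)%R[%classic : set (lebesgueR R)))
     (cos (2 * pi * d * k%:~R * x))%:E = 0)%E.
Proof.
move=> d0 k0; have w0 : 2 * pi * d * k%:~R != 0 :> R.
  apply: mulf_neq0; last by rewrite intr_eq0.
  by apply: lt0r_neq0; rewrite !mulr_gt0// pi_gt0.
apply: (integral_derive_period _ _ (fun x => is_derive_sin_scaled x w0)).
- by rewrite invr_gt0.
- move=> x; apply: continuous_comp; last exact: continuous_cos.
  by apply: continuousM; [exact: cst_continuous|].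
- rewrite mulr0; congr (_ * _).
  rewrite -[RHS](sinDz2pi 0 k) add0r; congr sin; field; exact: lt0r_neq0.
Qed.

Lemma integral_sin_period (R : realType) (d : R) (k : int) : 0 < d ->
  (\int[leb]_(x in (`[0%R, (d^-1)%R[%classic : set (lebesgueR R)))
     (sin (2 * pi * d * k%:~R * x))%:E = 0)%E.
Proof.
move=> d0; have [->|k0] := eqVneq k 0.
  by apply: integral0_eq => x _; rewrite mulr0 mul0r sin0.
have w0 : 2 * pi * d * k%:~R != 0 :> R.
  apply: mulf_neq0; last by rewrite intr_eq0.
  by apply: lt0r_neq0; rewrite !mulr_gt0// pi_gt0.
apply: (integral_derive_period _ _ (fun x => is_derive_cos_scaled x w0)).
- by rewrite invr_gt0.
- move=> x; apply: continuous_comp; last exact: continuous_sin.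
  by apply: continuousM; [exact: cst_continuous|].
- rewrite mulr0; congr (_ * _).
  rewrite -[RHS](cosDz2pi 0 k) add0r; congr cos; field; exact: lt0r_neq0.
Qed.

(** * Sets described by their fibers over the period *)

Section fibers.
Context {R : realType} (d : R) (M : nat).
Hypothesis d_gt0 : 0 < d.

Let I : set (lebesgueR R) := `[0, d^-1[%classic.

Let mI : measurable I.
Proof. exact: (borel_lebesgue (measurable_itv _)). Qed.

Let Ioo : (leb I < +oo)%E.
Proof. by rewrite leb_period// ltry. Qed.

(** The 2M points of Z/d from -M/d to (M - 1)/d, the index [i] standing for the integer i - M. With
    indices in a finite type, a fiber is a [{set 'I_(M.*2)}] and there are finitely many
    patterns. *)
Definition node (i : 'I_(M.*2)) : R := (i%:R - M%:R) / d.

(** After scaling by [d], this is uniqueness of the integer and fractional parts. *)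
Lemma node_inj x x' i j : I x -> I x' -> x + node i = x' + node j ->
  i = j /\ x = x'.
Proof.
rewrite /I/= !in_itv/= => /andP[x0 x1] /andP[x0' x1'] e.
have dx : d * x < 1 by rewrite -ltr_pdivlMl ?mulr1.
have dx' : d * x' < 1 by rewrite -ltr_pdivlMl ?mulr1.
have dx0 : 0 <= d * x by rewrite mulr_ge0// ltW.
have dx0' : 0 <= d * x' by rewrite mulr_ge0// ltW.
have e' : d * x + i%:R = d * x' + j%:R.
  have := congr1 (fun y => d * y) e; rewrite !mulrDr /node.
  by rewrite !(mulrC d (_ / d)) !divfK ?gt_eqF// => ?; lra.
have ij : i = j :> nat.
  have [ij|ji|//] := ltngtP i j; exfalso.
    have : i.+1%:R <= j%:R :> R by rewrite ler_nat.
    by rewrite -natr1; lra.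
  have : j.+1%:R <= i%:R :> R by rewrite ler_nat.
  by rewrite -natr1; lra.
have eij := val_inj ij; split => //.
by apply: (@addIr _ (node i)); rewrite e eij.
Qed.

Implicit Types P : R -> {set 'I_(M.*2)}.

(* The set whose fiber over [x] in the period is [{x + node i | i \in P x}]. *)
Definition fibered P : set (lebesgueR R) :=
  [set y | exists2 x, I x & exists2 i, i \in P x & y = x + node i].

Definition piece P i : set (lebesgueR R) := I `&` [set x | i \in P x].

Definition measurable_pattern P := forall i, measurable (piece P i).

Let shifted P i : set (lebesgueR R) := (fun x => x + - node i) @^-1` piece P i.

Let fiberedE P : fibered P = \big[setU/set0]_(i <- enum 'I_(M.*2)) shifted P i.
Proof.
apply/seteqP; split => [y [x Ix [i ix ->]]|y].
  rewrite -bigcup_seq; exists i => /=; first by rewrite mem_enum.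
  by rewrite /shifted/= addrK.
rewrite -bigcup_seq => -[i _ [Iy iy]].
by exists (y + - node i) => //; exists i => //; rewrite subrK.
Qed.

Let trivIset_shifted P : trivIset [set` enum 'I_(M.*2)] (shifted P).
Proof.
move=> i j _ _ [y [[Ii _] [Ij _]]].
by have [] := node_inj Ii Ij (_ : (y + - node i) + node i = (y + - node j) + node j);
  rewrite ?subrK.
Qed.

Let shifted_preimage P i :
  (fun x => x + node i) @^-1` shifted P i = piece P i.
Proof. by apply/seteqP; split => x; rewrite /shifted/= addrK. Qed.

Let measurable_shifted P i : measurable_pattern P -> measurable (shifted P i).
Proof. by move=> mP; exact: (measurable_preimage_shift (- node i) (mP i)). Qed.

Lemma measurable_fibered P : measurable_pattern P -> measurable (fibered P).
Proof.
move=> mP; rewrite fiberedE.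
by apply: bigsetU_measurable => i _; exact: measurable_shifted.
Qed.

Lemma measurable_fun_fiber P (h : R -> R) i : measurable_pattern P ->
  measurable_fun (fibered P) (h : lebesgueR R -> R) ->
  measurable_fun (piece P i) ((fun x => h (x + node i)) : lebesgueR R -> R).
Proof.
move=> mP mh.
apply: (@measurable_comp _ _ _ (lebesgueR R) (lebesgueR R) R (fibered P) h
  (piece P i) (fun x : R => x + node i)).
- exact: measurable_fibered.
- by move=> _ [x [Ix ix] <-]; exists x => //; exists i.
- exact: mh.
- exact: measurable_funTS (measurable_fun_shift (node i)).
Qed.

(** A fibered set is the disjoint union of translates of its pieces; each is translated back into
    the period and the integrand is extended by 0. *)
Let integral_fibered_sum P (h : R -> R) : measurable_pattern P ->
  measurable_fun (fibered P) (h : lebesgueR R -> R) ->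
  (\int[leb]_(y in fibered P) (h y)%:E =
   \sum_(i <- enum 'I_(M.*2))
     \int[leb]_(x in I) ((fun x => (h (x + node i))%:E) \_ (piece P i)) x)%E.
Proof.
move=> mP mh.
have mh' : measurable_fun (fibered P) (EFin \o h : lebesgueR R -> \bar R).
  exact/measurable_EFinP.
have := @integral_bigsetU_EFin _ (lebesgueR R) R leb _ (shifted P) h
  (enum 'I_(M.*2)) (fun i => measurable_shifted i mP) (enum_uniq _)
  (@trivIset_shifted P).
rewrite /= -fiberedE => /(_ mh') ->.
apply: eq_bigr => i _.
have mhi : measurable_fun (shifted P i) (EFin \o h : lebesgueR R -> \bar R).
  apply: (measurable_funS _ _ mh'); first exact: measurable_fibered.
  move=> y [Iy iy]; exists (y + - node i) => //.
  by exists i => //; rewrite subrK.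
rewrite (integral_shift (node i) (measurable_shifted i mP) mhi).
rewrite shifted_preimage -integral_mkcondr; congr (integral _ _ _).
by apply/seteqP; split => x //=; [case=> Ix ix; split|case].
Qed.

Let patch_fiber P (h : R -> R) i x : I x ->
  ((fun x => (h (x + node i))%:E) \_ (piece P i)) x =
  (if i \in P x then h (x + node i) else 0)%:E.
Proof.
move=> Ix; rewrite patchE; case: ifPn => [/set_mem[_ /= ->]//|/negP nix].
by case: ifPn => // ix; exfalso; apply: nix; apply/mem_set.
Qed.

Let measurable_patch P (h : R -> R) i : measurable_pattern P ->
  measurable_fun (fibered P) (h : lebesgueR R -> R) ->
  measurable_fun I
    ((fun x => (h (x + node i))%:E) \_ (piece P i) : lebesgueR R -> \bar R).
Proof.
move=> mP mh; apply/(measurable_restrict _ (mP i) mI).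
have -> : I `&` piece P i = piece P i by apply/setIidr => x [].
by apply/measurable_EFinP; exact: measurable_fun_fiber.
Qed.

(** This form serves for squared norms of elements of L^2, which need not be bounded; the one for
    bounded functions serves for exponentials, which change sign. *)
Lemma ge0_integral_fibered P (h : R -> R) : measurable_pattern P ->
  measurable_fun (fibered P) (h : lebesgueR R -> R) -> (forall y, 0 <= h y) ->
  (\int[leb]_(y in fibered P) (h y)%:E =
   \int[leb]_(x in I) (\sum_(i in P x) h (x + node i))%:E)%E.
Proof.
move=> mP mh h0; rewrite (integral_fibered_sum mP mh) -(ge0_integral_sum _ mI).
- apply: eq_integral => x /set_mem Ix; rewrite big_enum/= -sumEFin [RHS]big_mkcond/=.
  by apply: eq_bigr => i _; rewrite patch_fiber//; case: ifP.
- by move=> i; exact: measurable_patch.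
- by move=> i x Ix; rewrite patch_fiber// lee_fin; case: ifP.
Qed.

Lemma integral_fibered P (h : R -> R) : measurable_pattern P ->
  bddmeas (fibered P) h ->
  (\int[leb]_(y in fibered P) (h y)%:E =
   \int[leb]_(x in I) (\sum_(i in P x) h (x + node i))%:E)%E.
Proof.
move=> mP [mh [C hC]]; rewrite integral_fibered_sum// -integral_sum//.
- apply: eq_integral => x /set_mem Ix; rewrite big_enum/= -sumEFin [RHS]big_mkcond/=.
  by apply: eq_bigr => i _; rewrite patch_fiber//; case: ifP.
- move=> i; apply: (@le_integrable _ (lebesgueR R) R leb I mI _ (cst `|C|%:E)).
  + exact: measurable_patch.
  + move=> x Ix; rewrite patch_fiber// lee_fin normr_id.
    case: ifPn => ix; last by rewrite normr0.
    apply: (le_trans _ (ler_norm C)); apply: hC.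
    by exists x => //; exists i.
  + exact: (bddmeas_integrable mI Ioo (bddmeas_cst I `|C|)).
Qed.

Lemma measurable_fiber_sum P (h : R -> R) : measurable_pattern P ->
  measurable_fun (fibered P) (h : lebesgueR R -> R) ->
  measurable_fun I
    ((fun x => \sum_(i in P x) h (x + node i)) : lebesgueR R -> R).
Proof.
move=> mP mh.
apply: (@eq_measurable_fun _ _ (lebesgueR R) R I
  (fun x => \sum_i fine (((fun x => (h (x + node i))%:E) \_ (piece P i)) x))).
  move=> x /set_mem Ix; rewrite [RHS]big_mkcond/=.
  by apply: eq_bigr => i _; rewrite patch_fiber.
apply: measurable_sum => i; apply/measurable_EFinP.
apply: (eq_measurable_fun _ _ (measurable_patch i mP mh)).
by move=> x /set_mem Ix /=; rewrite patch_fiber.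
Qed.

Lemma bddmeas_fiber_sum P (h : R -> R) : measurable_pattern P ->
  bddmeas (fibered P) h ->
  bddmeas I (fun x => \sum_(i in P x) h (x + node i)).
Proof.
move=> mP [mh [C hC]]; split; first exact: measurable_fiber_sum.
exists (\sum_(i < M.*2) `|C|) => x Ix; rewrite big_mkcond/=.
apply: le_trans (ler_norm_sum _ _ _) _; apply: ler_sum => i _.
case: ifPn => ix; last by rewrite normr0.
by apply: (le_trans _ (ler_norm C)); apply: hC; exists x => //; exists i.
Qed.

End fibers.

(** * Complex exponentials *)

Section complex_exponential.
Context {R : realType}.
Implicit Types (s t x : R) (z : R[i]).

Lemma expi0 : expi (0 : R) = 1.
Proof. by rewrite /expi cos0 sin0. Qed.

Lemma expiD s t : expi (s + t) = expi s * expi t.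
Proof.
apply/eqP; rewrite eq_complex /= cosD sinD; apply/andP; split; apply/eqP; ring.
Qed.

Lemma conjc_expi t : conjc (expi t) = expi (- t).
Proof. by rewrite /expi /= cosN sinN. Qed.

Lemma conjc_realM_expi s t :
  conjc (real_complex R s * expi t) = real_complex R s * expi (- t).
Proof.
rewrite -conjc_expi; apply/eqP; rewrite eq_complex /=.
by apply/andP; split; apply/eqP; ring.
Qed.

Lemma expiDz2pi t (m : int) : expi (t + 2 * pi * m%:~R) = expi t.
Proof. by rewrite /expi cosDz2pi sinDz2pi. Qed.

Lemma expi_neq0 t : expi t != 0.
Proof.
apply/eqP => t0; have := expi0; rewrite -(subrr t) expiD t0 mul0r => /eqP.
by rewrite eq_sym oner_eq0.
Qed.

Definition sqnormc z : R := Normc.normc z ^+ 2.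

Lemma sqnormcE z : sqnormc z = complex.Re z ^+ 2 + complex.Im z ^+ 2.
Proof. by case: z => a b; rewrite /sqnormc /= sqr_sqrtr// addr_ge0 ?sqr_ge0. Qed.

Lemma sqnormc_ge0 z : 0 <= sqnormc z.
Proof. exact: sqr_ge0. Qed.

Lemma sqnormc0 : sqnormc 0 = 0.
Proof. by rewrite sqnormcE /= expr0n addr0. Qed.

Lemma sqnormc_eq0 z : (sqnormc z == 0) = (z == 0).
Proof.
apply/idP/eqP => [|->]; last by rewrite sqnormc0.
by rewrite sqrf_eq0 => /eqP/Normc.eq0_normc.
Qed.

Lemma sqnormcM z z' : sqnormc (z * z') = sqnormc z * sqnormc z'.
Proof. by rewrite /sqnormc Normc.normcM exprMn. Qed.

Lemma sqnormc_expi t : sqnormc (expi t) = 1.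
Proof. by rewrite sqnormcE /= cos2Dsin2. Qed.

Lemma real_complex_sqnormc z : real_complex R (sqnormc z) = z * conjc z.
Proof.
rewrite sqnormcE; case: z => a b; apply/eqP; rewrite eq_complex /=.
by apply/andP; split; apply/eqP; ring.
Qed.

Lemma Re_sum (I : Type) (r : seq I) (Q : pred I) (F : I -> R[i]) :
  complex.Re (\sum_(i <- r | Q i) F i) = \sum_(i <- r | Q i) complex.Re (F i).
Proof. by apply: (big_morph (@complex.Re R)) => // -[a b] [c e]. Qed.

Lemma Im_sum (I : Type) (r : seq I) (Q : pred I) (F : I -> R[i]) :
  complex.Im (\sum_(i <- r | Q i) F i) = \sum_(i <- r | Q i) complex.Im (F i).
Proof. by apply: (big_morph (@complex.Im R)) => // -[a b] [c e]. Qed.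

(** Pythagoras: a vector is at distance at least its own norm from anything orthogonal to it. *)
Lemma le_sum_sqnormcB (I : finType) (Q : pred I) (u v : I -> R[i]) :
  \sum_(i | Q i) u i * conjc (v i) = 0 ->
  \sum_(i | Q i) sqnormc (u i) <= \sum_(i | Q i) sqnormc (u i - v i).
Proof.
move=> uv0.
have e i : sqnormc (u i - v i) =
    sqnormc (u i) + sqnormc (v i) - 2 * complex.Re (u i * conjc (v i)).
  by rewrite !sqnormcE; case: (u i) (v i) => a b [c e] /=; ring.
rewrite (eq_bigr _ (fun i _ => e i)) big_split /= big_split /= -addrA lerDl.
rewrite sumrN -mulr_sumr -Re_sum uv0 /= mulr0 subr0.
by rewrite sumr_ge0// => i _; exact: sqnormc_ge0.
Qed.

End complex_exponential.

(** * Measurability and integrals of complex exponentials *)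

Section complex_measurable.
Context {R : realType}.
Implicit Types (D : set (lebesgueR R)) (f g : R -> R[i]).

Definition cmeasurable D f :=
  measurable_fun D ((fun x => complex.Re (f x)) : lebesgueR R -> R) /\
  measurable_fun D ((fun x => complex.Im (f x)) : lebesgueR R -> R).

Lemma cmeasurable_cst D c : cmeasurable D (fun=> c).
Proof. by split; exact: measurable_cst. Qed.

Lemma cmeasurableD D f g : cmeasurable D f -> cmeasurable D g ->
  cmeasurable D (fun x => f x + g x).
Proof.
move=> [rf jf] [rg jg]; split.
  apply: (eq_measurable_fun _ _ (measurable_funD rf rg)) => x _ /=.
  by case: (f x) (g x) => ? ? [].
apply: (eq_measurable_fun _ _ (measurable_funD jf jg)) => x _ /=.
by case: (f x) (g x) => ? ? [].
Qed.

Lemma cmeasurableM D f g : cmeasurable D f -> cmeasurable D g ->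
  cmeasurable D (fun x => f x * g x).
Proof.
move=> [rf jf] [rg jg]; split.
  apply: (eq_measurable_fun _ _ (measurable_funB (measurable_funM rf rg)
    (measurable_funM jf jg))) => x _ /=.
  by case: (f x) (g x) => ? ? [].
apply: (eq_measurable_fun _ _ (measurable_funD (measurable_funM rf jg)
  (measurable_funM jf rg))) => x _ /=.
by case: (f x) (g x) => ? ? [].
Qed.

Lemma cmeasurable_sum (I : Type) (r : seq I) (Q : pred I) D (F : I -> R -> R[i]) :
  (forall i, Q i -> cmeasurable D (F i)) ->
  cmeasurable D (fun x => \sum_(i <- r | Q i) F i x).
Proof.
move=> mF; elim: r => [|i r ih].
  by under eq_fun do rewrite big_nil; exact: cmeasurable_cst.
have [Qi|/negPf nQi] := boolP (Q i); last by under eq_fun do rewrite big_cons nQi.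
under eq_fun do rewrite big_cons Qi.
by apply: (cmeasurableD _ ih); exact: mF.
Qed.

Lemma cmeasurable_real D (f : R -> R) :
  measurable_fun D (f : lebesgueR R -> R) ->
  cmeasurable D (fun x => real_complex R (f x)).
Proof. by move=> mf; split => //=; exact: measurable_cst. Qed.

Lemma cmeasurable_expi D w : cmeasurable D (fun x => expi (w * x)).
Proof. by split; [have [] := bddmeas_cos D w|have [] := bddmeas_sin D w]. Qed.

Lemma cmeasurable_e_ (Omega : set (lebesgueR R)) D l : measurable Omega ->
  cmeasurable D (e_ Omega l).
Proof.
move=> mO; apply: cmeasurableM.
  apply: cmeasurableM; first exact: cmeasurable_cst.
  exact: cmeasurable_expi.
by apply: cmeasurable_real; apply: (measurable_indic mO).
Qed.

Lemma measurable_sqnormc D f : cmeasurable D f ->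
  measurable_fun D ((fun x => sqnormc (f x)) : lebesgueR R -> R).
Proof.
move=> [rf jf].
apply: (eq_measurable_fun _ _ (measurable_funD (measurable_funM rf rf)
  (measurable_funM jf jf))) => x _ /=.
by rewrite sqnormcE !expr2.
Qed.

Lemma inL2_bounded D f C : measurable D -> (leb D < +oo)%E -> cmeasurable D f ->
  (forall x, D x -> sqnormc (f x) <= C) -> inL2 D f.
Proof.
move=> mD Doo mf fC; have [rf jf] := mf; split => //.
have b : bddmeas D (fun x => sqnormc (f x)).
  split; first exact: measurable_sqnormc.
  by exists C => x Dx; rewrite ger0_norm ?fC// sqnormc_ge0.
have /integrableP[_] := bddmeas_integrable mD Doo b.
apply: le_lt_trans; rewrite le_eqVlt; apply/orP; left; apply/eqP.
by apply: eq_integral => x _ /=; rewrite ger0_norm// sqnormc_ge0.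
Qed.

Lemma e_E (Omega : set (lebesgueR R)) l x : Omega x -> e_ Omega l x =
  real_complex R (Num.sqrt (fine (leb Omega)))^-1 * expi (2 * pi * l * x).
Proof. by move=> Ox; rewrite /e_ indicE mem_set// mulr1. Qed.

Lemma inL2_e_ (Omega : set (lebesgueR R)) l : measurable Omega ->
  (leb Omega < +oo)%E -> inL2 Omega (e_ Omega l).
Proof.
move=> mO Ooo.
pose c := (Num.sqrt (fine (leb Omega)))^-1.
apply: (inL2_bounded (C := sqnormc (real_complex R c)) mO Ooo).
  exact: (cmeasurable_e_ _ _ mO).
by move=> x Ox; rewrite e_E// -/c sqnormcM sqnormc_expi mulr1.
Qed.

Lemma innerL2_e_ (Omega : set (lebesgueR R)) l l' : measurable Omega ->
    (leb Omega < +oo)%E ->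
  innerL2 Omega (e_ Omega l) (e_ Omega l') =
  Complex ((fine (leb Omega))^-1 * \int[leb]_(x in Omega) cos (2 * pi * (l - l') * x))
          ((fine (leb Omega))^-1 * \int[leb]_(x in Omega) sin (2 * pi * (l - l') * x)).
Proof.
move=> mO Ooo; set c := (fine (leb Omega))^-1.
have e x : Omega x -> e_ Omega l x * conjc (e_ Omega l' x) =
    Complex (c * cos (2 * pi * (l - l') * x)) (c * sin (2 * pi * (l - l') * x)).
  move=> Ox; rewrite !e_E// conjc_realM_expi mulrACA -expiD.
  have -> : 2 * pi * l * x + - (2 * pi * l' * x) = 2 * pi * (l - l') * x by ring.
  rewrite -rmorphM/= -invfM -expr2 sqr_sqrtr ?fine_ge0 ?measure_ge0// -/c.
  by apply/eqP; rewrite eq_complex /=; apply/andP; split; apply/eqP; ring.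
rewrite /innerL2 /complex_integral; congr Complex.
  rewrite -RintegralZl//; last exact: bddmeas_integrable mO Ooo (bddmeas_cos _ _).
  by apply: eq_Rintegral => x /set_mem Ox; rewrite e.
rewrite -RintegralZl//; last exact: bddmeas_integrable mO Ooo (bddmeas_sin _ _).
by apply: eq_Rintegral => x /set_mem Ox; rewrite e.
Qed.

End complex_measurable.

(** * Orthogonality on the fibers *)

Section spectral_patterns.
Context {R : realType} (d : R) (M : nat).
Variables (Omega : set (lebesgueR R)) (Lambda : set R).
Hypotheses (d_gt0 : 0 < d) (mO : measurable Omega).
Hypotheses (O_gt0 : (0 < leb Omega)%E) (Ooo : (leb Omega < +oo)%E).

Definition pattern (x : R) : {set 'I_(M.*2)} :=
  [set i | `[< Omega (x + node d i) >]].

(** That is, [M] is so large that Omega lies in [-M/d, M/d). *)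
Hypothesis OmegaE : fibered d pattern = Omega.
Hypothesis ortho : forall l l', Lambda l -> Lambda l' ->
  innerL2 Omega (e_ Omega l) (e_ Omega l') = (l == l')%:R.
Hypothesis LambdaD : forall l (k : int), Lambda l -> Lambda (l + d * k%:~R).

Let I : set (lebesgueR R) := `[0, d^-1[%classic.
Let V := fine (leb Omega).

Let mI : measurable I.
Proof. exact: (borel_lebesgue (measurable_itv _)). Qed.

Let Ioo : (leb I < +oo)%E.
Proof. by rewrite leb_period// ltry. Qed.

Let V_gt0 : 0 < V.
Proof. by rewrite fine_gt0// O_gt0. Qed.

Let lebOE : leb Omega = V%:E.
Proof. by rewrite fineK// ge0_fin_numE// ltW. Qed.

Lemma measurable_pattern_pattern : measurable_pattern d pattern.
Proof.
move=> i; rewrite /piece.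
have -> : [set x | i \in pattern x] = (fun x => x + node d i) @^-1` Omega.
  by apply/seteqP; split => x /=; rewrite inE => /asboolP.
by apply: (measurableI _ _ mI); exact: measurable_preimage_shift.
Qed.

Let mP := measurable_pattern_pattern.

Let ortho_int l l' : Lambda l -> Lambda l' -> l != l' ->
  (\int[leb]_(x in Omega) (cos (2 * pi * (l - l') * x))%:E = 0)%E /\
  (\int[leb]_(x in Omega) (sin (2 * pi * (l - l') * x))%:E = 0)%E.
Proof.
move=> Ll Ll' ll'; have := ortho Ll Ll'.
rewrite innerL2_e_// (negPf ll') -/V => -[hc hs].
have V0 : V^-1 != 0 by rewrite invr_neq0// gt_eqF.
have aux f : bddmeas Omega f -> V^-1 * \int[leb]_(x in Omega) f x = 0 ->
    (\int[leb]_(x in Omega) (f x)%:E = 0)%E.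
  move=> bf /eqP; rewrite mulf_eq0 (negPf V0)/= => /eqP f0.
  rewrite -[LHS]fineK; first by rewrite -[fine _]/(\int[leb]_(x in Omega) f x) f0.
  exact: (integrable_fin_num mO (bddmeas_integrable mO Ooo bf)).
split; first exact: (aux _ (bddmeas_cos _ _) hc).
exact: (aux _ (bddmeas_sin _ _) hs).
Qed.

Let shift_node (k : int) x (i : 'I_(M.*2)) :
  2 * pi * d * k%:~R * (x + node d i) =
  2 * pi * d * k%:~R * x + 2 * pi * (k * (i%:Z - M%:Z))%:~R.
Proof. by rewrite intrM intrB -!pmulrn /node; field; exact: lt0r_neq0. Qed.

(** A character of frequency d k takes the same value at all points of a fiber, since d k times a
    node is an integer. It factors out of the fiber sum, so the coefficients of the folded function
    are integrals over Omega. *)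
Let fourier_fiber (f : R -> R) (k : int) : bddmeas Omega f ->
  (\int[leb]_(x in I) ((\sum_(i in pattern x) f (x + node d i)) *
      cos (2 * pi * d * k%:~R * x))%:E =
   \int[leb]_(y in Omega) (f y * cos (2 * pi * d * k%:~R * y))%:E)%E /\
  (\int[leb]_(x in I) ((\sum_(i in pattern x) f (x + node d i)) *
      sin (2 * pi * d * k%:~R * x))%:E =
   \int[leb]_(y in Omega) (f y * sin (2 * pi * d * k%:~R * y))%:E)%E.
Proof.
move=> bf.
have bc := bddmeasM bf (bddmeas_cos Omega (2 * pi * d * k%:~R)).
have bs := bddmeasM bf (bddmeas_sin Omega (2 * pi * d * k%:~R)).
rewrite -OmegaE in bc bs *; split.
  rewrite (integral_fibered d_gt0 mP bc); apply: eq_integral => x _.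
  congr (_%:E); rewrite mulr_suml; apply: eq_bigr => i _.
  by rewrite shift_node cosDz2pi.
rewrite (integral_fibered d_gt0 mP bs); apply: eq_integral => x _.
congr (_%:E); rewrite mulr_suml; apply: eq_bigr => i _.
by rewrite shift_node sinDz2pi.
Qed.

Let bddmeas_fiber (f : R -> R) : bddmeas Omega f ->
  bddmeas I (fun x => \sum_(i in pattern x) f (x + node d i)).
Proof.
move=> bf; have := @bddmeas_fiber_sum _ d M pattern f mP.
by rewrite OmegaE; apply.
Qed.

Let fiber_ae0 (f : R -> R) : bddmeas Omega f ->
  (forall k : int,
    (\int[leb]_(y in Omega) (f y * cos (2 * pi * d * k%:~R * y))%:E = 0)%E /\
    (\int[leb]_(y in Omega) (f y * sin (2 * pi * d * k%:~R * y))%:E = 0)%E) ->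
  {ae leb, forall x, I x -> \sum_(i in pattern x) f (x + node d i) = 0}.
Proof.
move=> bf f0; apply: (fourier_null_ae0 d_gt0); have bF := bddmeas_fiber bf.
split; first exact: bF.
move=> k; have [c0 s0] := f0 k; have [ec es] := fourier_fiber k bf.
split; split.
- exact: (bddmeasM bF (bddmeas_cos _ _)).
- by rewrite -c0; exact: ec.
- exact: (bddmeasM bF (bddmeas_sin _ _)).
- by rewrite -s0; exact: es.
Qed.

Definition congruent (l l' : R) := exists k : int, l' = l + d * k%:~R.

Definition gram_entry (l l' : R) : R :=
  if `[< congruent l l' >] then d * V else 0.

(* The Gram matrix of the characters on the fiber [S], seen as a function of the
   difference of two frequencies. *)
Definition char_sum (S : {set 'I_(M.*2)}) (t : R) : R[i] :=
  \sum_(i in S) expi (2 * pi * t * node d i).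

Let integral_lin0 (f g : R -> R) (a b : R) : bddmeas Omega f -> bddmeas Omega g ->
  (\int[leb]_(y in Omega) (f y)%:E = 0)%E ->
  (\int[leb]_(y in Omega) (g y)%:E = 0)%E ->
  (\int[leb]_(y in Omega) (a * f y + b * g y)%:E = 0)%E.
Proof.
move=> bf bg f0 g0.
have jf := bddmeas_integrable mO Ooo bf; have jg := bddmeas_integrable mO Ooo bg.
have jaf := bddmeas_integrable mO Ooo (bddmeasM (bddmeas_cst Omega a) bf).
have jbg := bddmeas_integrable mO Ooo (bddmeasM (bddmeas_cst Omega b) bg).
have := integralD_EFin mO jaf jbg; move=> /= ->.
have := integralZl mO jf a; rewrite /= f0 mule0 => ->.
by have := integralZl mO jg b; rewrite /= g0 mule0 => ->; rewrite adde0.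
Qed.

(** All coefficients of |A(x)| - d V vanish: for [k] nonzero because [l + d * k%:~R] and [l] are
    distinct frequencies of Lambda, and for [k = 0] because |A(x)| has integral V over a period of
    length 1/d. *)
Let card_pattern_ae l : Lambda l ->
  {ae leb, forall x, I x -> #|pattern x|%:R = d * V}.
Proof.
move=> Ll.
have b1 := bddmeas_cst Omega (1 : R).
have bF := bddmeas_fiber b1.
have eF : {in I, (fun x => \sum_(i in pattern x) (1 : R)) =1
                 (fun x => #|pattern x|%:R)}.
  by move=> x _; rewrite sumr_const.
have bC := bddmeas_eq eF bF.
have bg : bddmeas I (fun x => #|pattern x|%:R + - (d * V)).
  exact: (bddmeasD bC (bddmeas_cst I _)).
have main : fourier_null d (fun x => #|pattern x|%:R + - (d * V)).
  split; first exact: bg.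
  move=> k.
  have [ec es] := fourier_fiber k b1.
  (* Here [t] is the cosine or the sine of index [k], and [c] is its integral over Omega, which by
     folding is the coefficient of the cardinality; the constant d V has to have the same one. *)
  have aux (t : R -> R) (c : \bar R) : bddmeas I t ->
      (\int[leb]_(x in I) ((\sum_(i in pattern x) 1) * t x)%:E = c)%E ->
      ((d * V)%:E * \int[leb]_(x in I) (t x)%:E = c)%E -> c \is a fin_num ->
      mean_zero d (fun x => (#|pattern x|%:R + - (d * V)) * t x).
    move=> bt e1 e2 cfin; split; first exact: (bddmeasM bg bt).
    have jt := bddmeas_integrable mI Ioo bt.
    have j1 := bddmeas_integrable mI Ioo (bddmeasM bC bt).
    have j2 := bddmeas_integrable mI Ioo (bddmeasM (bddmeas_cst I (d * V)) bt).
    transitivity (\int[leb]_(x in I) (#|pattern x|%:R * t x)%:E -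
                  \int[leb]_(x in I) ((d * V) * t x)%:E)%E.
      have := integralB_EFin mI j1 j2; move=> /= <-.
      by apply: eq_integral => x _; congr (_%:E); ring.
    have := integralZl mI jt (d * V); move=> /= ->.
    rewrite e2; have -> : (\int[leb]_(x in I) (#|pattern x|%:R * t x)%:E = c)%E.
      by rewrite -e1; apply: eq_integral => x _; rewrite sumr_const.
    by rewrite subee.
  split.
    apply: (aux _ _ (bddmeas_cos _ _) ec); last first.
      exact: (integrable_fin_num mO (bddmeas_integrable mO Ooo
        (bddmeasM b1 (bddmeas_cos Omega _)))).
    under [RHS]eq_integral do rewrite mul1r.
    have [->|k0] := eqVneq k 0.
      have cint (D : set (lebesgueR R)) : measurable D ->
          (\int[leb]_(x in D) (cos (2 * pi * d * 0%:~R * x))%:E = leb D)%E.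
        move=> mD; rewrite -[RHS]mul1e -(integral_cst leb mD 1%E).
        by apply: eq_integral => x _; rewrite mulr0 mul0r cos0.
      rewrite (cint I mI) (cint Omega mO) leb_period// lebOE -EFinM; congr (_%:E).
      by rewrite mulrAC mulfV ?mul1r// gt_eqF.
    rewrite integral_cos_period// mule0.
    have [|hc _] := @ortho_int (l + d * k%:~R) l (LambdaD k Ll) Ll.
      rewrite -subr_eq0 addrAC subrr add0r.
      by apply: mulf_neq0; [exact: lt0r_neq0|rewrite intr_eq0].
    rewrite -hc; apply: eq_integral => x _; congr ((cos _)%:E); ring.
  apply: (aux _ _ (bddmeas_sin _ _) es); last first.
    exact: (integrable_fin_num mO (bddmeas_integrable mO Ooo
      (bddmeasM b1 (bddmeas_sin Omega _)))).
  under [RHS]eq_integral do rewrite mul1r.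
  rewrite integral_sin_period// mule0.
  have [->|k0] := eqVneq k 0.
    by apply/esym; apply: integral0_eq => x _; rewrite mulr0 mul0r sin0.
  have [|_ hs] := @ortho_int (l + d * k%:~R) l (LambdaD k Ll) Ll.
    rewrite -subr_eq0 addrAC subrr add0r.
      by apply: mulf_neq0; [exact: lt0r_neq0|rewrite intr_eq0].
  rewrite -hs; apply: eq_integral => x _; congr ((sin _)%:E); ring.
have : {ae leb, forall x, I x -> #|pattern x|%:R + - (d * V) = 0}.
  exact: (fourier_null_ae0 d_gt0 main).
apply: filterS => x h Ix.
by apply/eqP; rewrite -subr_eq0; apply/eqP; exact: h.
Qed.

(** For congruent frequencies every term is 1 and the sum is the cardinality. Otherwise
    [l + d * k%:~R] differs from [l'] for every [k], and the product-to-sum formulas make all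
    coefficients of the folded exponential vanish. *)
Let gram_ae l l' : Lambda l -> Lambda l' ->
  {ae leb, forall x, I x ->
     char_sum (pattern x) (l - l') = real_complex R (gram_entry l l')}.
Proof.
move=> Ll Ll'; rewrite /gram_entry; case: asboolP => [[k e]|nc].
  have := card_pattern_ae Ll; apply: filterS => x h Ix.
  rewrite -(h Ix) /char_sum rmorph_nat -sumr_const; apply: eq_bigr => i _.
  rewrite -expi0 -(expiDz2pi 0 (- k * (i%:Z - M%:Z))) add0r; congr expi.
  by rewrite e intrM intrN intrB -!pmulrn /node; field; exact: lt0r_neq0.
pose t := 2 * pi * (l - l').
have ne (k : int) : l + d * k%:~R != l'.
  by apply/eqP => h; apply: nc; exists k.
have hcs (k : int) :
  [/\ (\int[leb]_(x in Omega) (cos ((t + 2 * pi * d * k%:~R) * x))%:E = 0)%E,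
      (\int[leb]_(x in Omega) (sin ((t + 2 * pi * d * k%:~R) * x))%:E = 0)%E,
      (\int[leb]_(x in Omega) (cos ((t - 2 * pi * d * k%:~R) * x))%:E = 0)%E &
      (\int[leb]_(x in Omega) (sin ((t - 2 * pi * d * k%:~R) * x))%:E = 0)%E].
  have [c1 s1] := ortho_int (LambdaD k Ll) Ll' (ne k).
  have [c2 s2] := ortho_int (LambdaD (- k) Ll) Ll' (ne (- k)).
  have e1 : 2 * pi * (l + d * k%:~R - l') = t + 2 * pi * d * k%:~R by rewrite /t; ring.
  have e2 : 2 * pi * (l + d * (- k)%:~R - l') = t - 2 * pi * d * k%:~R.
    by rewrite /t intrN; ring.
  by rewrite e1 in c1 s1; rewrite e2 in c2 s2.
have bc w := bddmeas_cos Omega w; have bs w := bddmeas_sin Omega w.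
have hc : {ae leb, forall x, I x ->
    \sum_(i in pattern x) cos (t * (x + node d i)) = 0}.
  apply: (fiber_ae0 (bc t)) => k; have [c1 s1 c2 s2] := hcs k.
  set w := 2 * pi * d * k%:~R in c1 s1 c2 s2 *; split.
    rewrite -[RHS](integral_lin0 2^-1 2^-1 (bc _) (bc _) c1 c2).
    apply: eq_integral => x _; congr (_%:E).
    by rewrite !mulrDl !mulNr cosD cosB; field.
  rewrite -[RHS](integral_lin0 2^-1 (- 2^-1) (bs _) (bs _) s1 s2).
  apply: eq_integral => x _; congr (_%:E).
  by rewrite !mulrDl !mulNr sinD sinB; field.
have hs : {ae leb, forall x, I x ->
    \sum_(i in pattern x) sin (t * (x + node d i)) = 0}.
  apply: (fiber_ae0 (bs t)) => k; have [c1 s1 c2 s2] := hcs k.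
  set w := 2 * pi * d * k%:~R in c1 s1 c2 s2 *; split.
    rewrite -[RHS](integral_lin0 2^-1 2^-1 (bs _) (bs _) s1 s2).
    apply: eq_integral => x _; congr (_%:E).
    by rewrite !mulrDl !mulNr sinD sinB; field.
  rewrite -[RHS](integral_lin0 2^-1 (- 2^-1) (bc _) (bc _) c2 c1).
  apply: eq_integral => x _; congr (_%:E).
  by rewrite !mulrDl !mulNr cosB cosD; field.
apply: filterS2 hc hs => x hc hs Ix.
(* The vanishing fiber sum carries the phase of [x]; once this nonzero factor is removed, what is
   left depends on the pattern alone. *)
have : expi (t * x) * char_sum (pattern x) (l - l') = 0.
  rewrite /char_sum mulr_sumr.
  have -> : \sum_(i in pattern x) expi (t * x) * expi (2 * pi * (l - l') * node d i)
    = \sum_(i in pattern x) expi (t * (x + node d i)).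
    apply: eq_bigr => i _; rewrite -expiD; congr expi; rewrite /t; ring.
  apply/eqP; rewrite eq_complex Re_sum Im_sum /=; apply/andP; split; apply/eqP.
    exact: hc.
  exact: hs.
by move=> /eqP; rewrite mulf_eq0 (negPf (expi_neq0 _))/= => /eqP.
Qed.

Definition level (S : {set 'I_(M.*2)}) : set (lebesgueR R) :=
  I `&` [set x | pattern x = S].

Lemma measurable_level S : measurable (level S).
Proof.
have -> : level S = \bigcap_(i in [set: 'I_(M.*2)])
    (if i \in S then piece d pattern i else I `\` piece d pattern i) `&` I.
  apply/seteqP; split => x.
    move=> [Ix <-]; split => // i _.
    case: ifPn => ix; first by split.
    by split => // -[_ /=]; exact/negP.
  move=> [h Ix]; split => //=; apply/setP => i.
  have := h i Logic.I; case: ifPn => iS; first by move=> [_ ->].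
  by move=> [_ ix]; apply/negbTE/negP => ix'; apply: ix; split.
apply: (measurableI _ _ _ mI); apply: fin_bigcap_measurable => // i _.
case: ifP => _; first exact: mP.
by apply: (measurableD mI); exact: mP.
Qed.

Definition good S := leb (level S) != 0%E.

(** A level set of positive measure is not contained in the null exceptional set of [gram_ae], and
    one point of it outside that set is enough, the identity involving only the pattern. *)
Lemma gram S l l' : good S -> Lambda l -> Lambda l' ->
  char_sum S (l - l') = real_complex R (gram_entry l l').
Proof.
move=> gS Ll Ll'; apply: contrapT => h; move/negP: gS; apply; apply/eqP.
have [N [mN N0 sN]] := gram_ae Ll Ll'.
apply: (@subset_measure0 _ (lebesgueR R) R leb _ _ (measurable_level S) mN _ N0).
by move=> x [Ix xS]; apply: sN => /= /(_ Ix); rewrite (xS : pattern x = S).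
Qed.

(** There are finitely many patterns, so the level sets of measure zero have a null union. *)
Lemma ae_good : {ae leb, forall x, I x -> good (pattern x)}.
Proof.
have h S : {ae leb, forall x, I x -> pattern x = S -> good S}.
  have [gS|/negPn/eqP bS] := boolP (good S); first by apply: aeW => x.
  exists (level S); split => //; first exact: measurable_level.
  by move=> x /= /not_implyP[Ix /not_implyP[xS _]].
have : {ae leb, forall x S, I x -> pattern x = S -> good S}.
  exact: filter_forall.
by apply: filterS => x /(_ (pattern x)) + Ix => /(_ Ix erefl).
Qed.

End spectral_patterns.

(** * Frequencies modulo d *)

Section congruence.
Context {R : realType} (d : R).
Implicit Types l : R.

Lemma congruent_refl l : congruent d l l.
Proof. by exists 0; rewrite mulr0 addr0. Qed.

Lemma congruent_sym l l' : congruent d l l' -> congruent d l' l.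
Proof. by move=> [k ->]; exists (- k); rewrite intrN mulrN addrK. Qed.

Lemma congruent_trans l l' l'' :
  congruent d l l' -> congruent d l' l'' -> congruent d l l''.
Proof. by move=> [k ->] [m ->]; exists (k + m); rewrite intrD mulrDr addrA. Qed.

Definition representatives (Lambda : set R) (G : seq R) :=
  [/\ uniq G, forall g, g \in G -> Lambda g,
      forall g g', g \in G -> g' \in G -> congruent d g g' -> g = g' &
      forall l, Lambda l -> exists2 g, g \in G & congruent d l g].

(** The given generators may be congruent to one another. By induction, a generator congruent to one
    already kept is dropped, so that distinct representatives give orthogonal rows. *)
Lemma periodic_representatives (Lambda : set R) : periodic_set d Lambda ->
  exists G, representatives Lambda G.
Proof.
move=> [gamma ->]; elim: gamma => [|a s [G [uG LG iG cG]]].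
  by exists [::]; split => // l [g].
have sub l : minkowski_sum [set` s] (scaledZ d) l ->
    minkowski_sum [set` a :: s] (scaledZ d) l.
  move=> [g gs [z zd] <-]; exists g; last by exists z.
  by rewrite /= inE gs orbT.
have cons l : minkowski_sum [set` a :: s] (scaledZ d) l ->
    congruent d l a \/ minkowski_sum [set` s] (scaledZ d) l.
  move=> [g]; rewrite /= inE => /orP[/eqP->|gs] [_ [k _ <-] <-].
    by left; apply: congruent_sym; exists k.
  by right; exists g => //; exists (d * k%:~R) => //; exists k.
have [[g gG ag]|nag] := pselect (exists2 g, g \in G & congruent d a g).
  exists G; split => // [g' /LG/sub//|l /cons[la|/cG//]].
  by exists g => //; exact: congruent_trans ag.
exists (a :: G); split.
- rewrite /= uG andbT; apply/negP => aG; apply: nag; exists a => //.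
  exact: congruent_refl.
- move=> g; rewrite inE => /orP[/eqP->|/LG/sub//].
  exists a; first by rewrite /= inE eqxx.
  by exists 0; [exists 0 => //; rewrite mulr0|rewrite addr0].
- move=> g g'; rewrite !inE => /orP[/eqP->|gG] /orP[/eqP->|g'G] //.
  + by move=> ag'; exfalso; apply: nag; exists g'.
  + by move=> /congruent_sym ag; exfalso; apply: nag; exists g.
  + exact: iG.
- move=> l /cons[la|/cG[g gG lg]]; first by exists a => //; rewrite inE eqxx.
  by exists g => //; rewrite inE gG orbT.
Qed.

Lemma expi_congruent (M : nat) l l' (i : 'I_(M.*2)) : 0 < d -> congruent d l l' ->
  expi (2 * pi * l' * node d i) = expi (2 * pi * l * node d i).
Proof.
move=> d0 [k ->]; rewrite -[RHS](expiDz2pi _ (k * (i%:Z - M%:Z))); congr expi.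
by rewrite intrM intrB -!pmulrn /node; field; exact: lt0r_neq0.
Qed.

End congruence.

(** * Measurability of restrictions and translates *)

Lemma bddmeas_indic_shift (R : realType) (D E : set (lebesgueR R)) (t : R) :
  measurable D -> bddmeas E (fun y => \1_D (y + t)).
Proof.
move=> mD; split; last first.
  by exists 1 => x _; rewrite indicE; case: (_ \in _); rewrite /= ?normr1 ?normr0.
apply: measurable_funTS.
by apply: (measurableT_comp (measurable_indic mD)); exact: measurable_fun_shift.
Qed.

Lemma cmeasurable_restrict (R : realType) (D : set (lebesgueR R)) (f : R -> R[i]) :
  measurable D -> cmeasurable D f ->
  cmeasurable setT (fun y => real_complex R (\1_D y) * f y).
Proof.
move=> mD [rf jf]; split.
  apply: (@eq_measurable_fun _ _ (lebesgueR R) R setT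
    ((fun x => complex.Re (f x)) \_ D)); last first.
    by apply/(measurable_restrict _ mD measurableT); rewrite setTI.
  move=> x _; rewrite /patch indicE; case: (x \in D).
    by case: (f x) => a b /=; rewrite mul1r mul0r subr0.
  by case: (f x) => a b /=; rewrite !mul0r subr0.
apply: (@eq_measurable_fun _ _ (lebesgueR R) R setT
  ((fun x => complex.Im (f x)) \_ D)); last first.
  by apply/(measurable_restrict _ mD measurableT); rewrite setTI.
move=> x _; rewrite /patch indicE; case: (x \in D).
  by case: (f x) => a b /=; rewrite mul1r mul0r addr0.
by case: (f x) => a b /=; rewrite !mul0r addr0.
Qed.

Lemma cmeasurable_shift (R : realType) (D : set (lebesgueR R)) (f : R -> R[i]) (t : R) :
  cmeasurable setT f -> cmeasurable D (fun y => f (y + t)).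
Proof.
move=> [rf jf]; split; apply: measurable_funTS.
  exact: (measurableT_comp rf (measurable_fun_shift t)).
exact: (measurableT_comp jf (measurable_fun_shift t)).
Qed.

Lemma conjcM (R : realType) (u v : R[i]) : conjc (u * v) = conjc u * conjc v.
Proof. exact: rmorphM. Qed.

(** * Fiber sums that depend only on the Gram matrix *)

Section gram_invariance.
Context {R : realType} (d : R) (M : nat).
Variables (Omega : set (lebesgueR R)) (Lambda : set R).
Hypothesis d_gt0 : 0 < d.
Hypothesis gramE : forall (S : {set 'I_(M.*2)}) l l', good d Omega S ->
  Lambda l -> Lambda l' ->
  char_sum d S (l - l') = real_complex R (gram_entry d Omega l l').

Notation rc := (real_complex R).
Notation a := (@node R d M).

(** Expanding the square leaves only coefficients, phases of [x] and Gram entries, none of which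
    depends on the good pattern. [L] lists pairs of a frequency and a coefficient, with repetitions
    allowed. *)
Lemma sum_sqnormc_gram (L : seq (R * R[i])) (S S' : {set 'I_(M.*2)}) x :
  good d Omega S -> good d Omega S' -> (forall p, p \in L -> Lambda p.1) ->
  \sum_(i in S) sqnormc (\sum_(p <- L) p.2 * expi (2 * pi * p.1 * (x + a i))) =
  \sum_(i in S') sqnormc (\sum_(p <- L) p.2 * expi (2 * pi * p.1 * (x + a i))).
Proof.
move=> gS gS' LL.
have key (U : {set 'I_(M.*2)}) : good d Omega U ->
    rc (\sum_(i in U) sqnormc (\sum_(p <- L) p.2 * expi (2 * pi * p.1 * (x + a i)))) =
    \sum_(p <- L) \sum_(q <- L) p.2 * conjc q.2 *
      (expi (2 * pi * (p.1 - q.1) * x) * rc (gram_entry d Omega p.1 q.1)).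
  move=> gU; rewrite rmorph_sum /=.
  transitivity (\sum_(i in U) \sum_(p <- L) \sum_(q <- L) p.2 * conjc q.2 *
      (expi (2 * pi * (p.1 - q.1) * x) * expi (2 * pi * (p.1 - q.1) * a i))).
    apply: eq_bigr => i _; rewrite real_complex_sqnormc rmorph_sum /= mulr_suml.
    apply: eq_bigr => p _; rewrite mulr_sumr; apply: eq_bigr => q _.
    rewrite conjcM conjc_expi mulrACA -!expiD; congr (_ * expi _).
    ring.
  rewrite exchange_big /=; apply: eq_big_seq => p pL.
  rewrite exchange_big /=; apply: eq_big_seq => q qL.
  rewrite -mulr_sumr -mulr_sumr -/(char_sum d U (p.1 - q.1)).
  by rewrite (gramE gU (LL _ pL) (LL _ qL)).
by apply: complexI; rewrite !key.
Qed.

Lemma sum_trig_gram (S S' : {set 'I_(M.*2)}) l l' x :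
  good d Omega S -> good d Omega S' -> Lambda l -> Lambda l' ->
  \sum_(i in S) cos (2 * pi * (l - l') * (x + a i)) =
    \sum_(i in S') cos (2 * pi * (l - l') * (x + a i)) /\
  \sum_(i in S) sin (2 * pi * (l - l') * (x + a i)) =
    \sum_(i in S') sin (2 * pi * (l - l') * (x + a i)).
Proof.
move=> gS gS' Ll Ll'.
have key (U : {set 'I_(M.*2)}) :
    \sum_(i in U) expi (2 * pi * (l - l') * (x + a i)) =
    expi (2 * pi * (l - l') * x) * char_sum d U (l - l').
  rewrite /char_sum mulr_sumr; apply: eq_bigr => i _.
  by rewrite -expiD; congr expi; ring.
have := key S; rewrite (gramE gS Ll Ll') -(gramE gS' Ll Ll') -key.
move=> /eqP; rewrite eq_complex !Re_sum !Im_sum /= => /andP[/eqP ? /eqP ?].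
by split.
Qed.

End gram_invariance.

(** * Completeness on the fibers *)

#[local] Arguments expi : simpl never.
#[local] Arguments conjc : simpl never.

Lemma cmeasurable_eq (R : realType) (D : set (lebesgueR R)) (f g : R -> R[i]) :
  (forall x, f x = g x) -> cmeasurable D f -> cmeasurable D g.
Proof. by move=> /funext ->. Qed.

Lemma inL2_bddmeas (R : realType) (D : set (lebesgueR R)) (f : R -> R[i]) :
  measurable D -> (leb D < +oo)%E ->
  bddmeas D (fun x => complex.Re (f x)) -> bddmeas D (fun x => complex.Im (f x)) ->
  inL2 D f.
Proof.
move=> mD Doo bre bim.
have [_ [C hC]] := bddmeasD (bddmeasM bre bre) (bddmeasM bim bim).
apply: (inL2_bounded (C := C) mD Doo); first by split; [have [] := bre|have [] := bim].
by move=> x Dx; rewrite sqnormcE !expr2 (le_trans (ler_norm _))// hC.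
Qed.

Section column_orthogonality.
Context {R : realType} (d : R) (M : nat).
Variables (Omega : set (lebesgueR R)) (Lambda : set R).
Hypotheses (d_gt0 : 0 < d) (mO : measurable Omega).
Hypotheses (O_gt0 : (0 < leb Omega)%E) (Ooo : (leb Omega < +oo)%E).
Hypothesis OmegaE : fibered d (@pattern R d M Omega) = Omega.
Hypothesis gramE : forall (S : {set 'I_(M.*2)}) l l', good d Omega S ->
  Lambda l -> Lambda l' ->
  char_sum d S (l - l') = real_complex R (gram_entry d Omega l l').
Hypothesis dense : forall f, inL2 Omega f -> forall eps : R, 0 < eps ->
  exists (s : seq R) (c : R -> R[i]),
    (forall l, l \in s -> Lambda l) /\
    (sqnormL2 Omega (fun x => f x - \sum_(l <- s) c l * e_ Omega l x)%R
       < (eps ^+ 2)%:E)%E.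
Variable G : seq R.
Hypothesis repG : representatives d Lambda G.

Notation rc := (real_complex R).
Notation a := (@node R d M).

Let I : set (lebesgueR R) := `[0, d^-1[%classic.
Let N := d * fine (leb Omega).

Let N_gt0 : 0 < N.
Proof. by rewrite mulr_gt0// fine_gt0// O_gt0. Qed.

Let mI : measurable I.
Proof. exact: (borel_lebesgue (measurable_itv _)). Qed.

Let mP := @measurable_pattern_pattern R d M Omega mO.

(** Inner product of the columns [j] and [i] of the matrix e(g a). *)
Definition column_sum (i j : 'I_(M.*2)) : R[i] :=
  \sum_(g <- G) expi (2 * pi * g * (a j - a i)).

(** Exactly one representative is congruent to [l], and it alone has a nonzero Gram entry. *)
Let sum_representatives l (f : R -> R[i]) : Lambda l ->
  (forall g, congruent d l g -> f g = f l) ->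
  \sum_(g <- G) f g * rc (gram_entry d Omega g l) = rc N * f l.
Proof.
move=> Ll fE; have [uG LG iG cG] := repG; have [g0 g0G lg0] := cG l Ll.
rewrite (bigD1_seq g0)//= big1_seq ?addr0; last first.
  move=> g /andP[gg0 gG]; rewrite /gram_entry asboolF ?mulr0// => gl.
  move/eqP: gg0; apply; apply: iG => //.
  exact: congruent_trans lg0.
rewrite (fE g0 lg0) /gram_entry asboolT; last exact: congruent_sym.
exact: mulrC.
Qed.

(** The [i]-th basis vector minus its projection onto the span of the rows; these are orthogonal of
    square norm N, which explains the factor 1/N. *)
Let residual (i j : 'I_(M.*2)) : R[i] := (j == i)%:R - rc N^-1 * column_sum i j.

Let residual_ortho (S : {set 'I_(M.*2)}) i l : good d Omega S -> i \in S -> Lambda l ->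
  \sum_(j in S) residual i j * conjc (expi (2 * pi * l * a j)) = 0.
Proof.
move=> gS iS Ll.
transitivity (\sum_(j in S) (j == i)%:R * conjc (expi (2 * pi * l * a j)) -
  rc N^-1 * \sum_(j in S) column_sum i j * conjc (expi (2 * pi * l * a j))).
  rewrite mulr_sumr -sumrB; apply: eq_bigr => j _.
  by rewrite /residual mulrBl mulrA.
have -> : \sum_(j in S) (j == i)%:R * conjc (expi (2 * pi * l * a j)) =
    conjc (expi (2 * pi * l * a i)).
  rewrite (bigD1 i)//= eqxx mul1r big1 ?addr0// => j /andP[_ /negPf->].
  by rewrite mul0r.
have -> : \sum_(j in S) column_sum i j * conjc (expi (2 * pi * l * a j)) =
    \sum_(g <- G) conjc (expi (2 * pi * g * a i)) * rc (gram_entry d Omega g l).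
  have [_ LG _ _] := repG.
  transitivity (\sum_(g <- G) conjc (expi (2 * pi * g * a i)) * char_sum d S (g - l)).
    rewrite /char_sum; under [RHS]eq_bigr do rewrite mulr_sumr.
    rewrite [RHS]exchange_big /=; apply: eq_bigr => j _.
    rewrite /column_sum mulr_suml; apply: eq_bigr => g _.
    by rewrite !conjc_expi -!expiD; congr expi; ring.
  by apply: eq_big_seq => g gG; rewrite (gramE gS (LG _ gG) Ll).
rewrite (@sum_representatives l (fun g => conjc (expi (2 * pi * g * a i))))//.
  by rewrite mulrA -rmorphM/= mulVf ?gt_eqF// rmorph1 mul1r subrr.
by move=> g lg; rewrite (expi_congruent i d_gt0 lg).
Qed.

(* The vector [residual i], placed on the fibers of pattern [S], is orthogonal to
   every exponential and hence vanishes by density. *)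
Lemma column_ortho (S : {set 'I_(M.*2)}) i j : good d Omega S ->
  i \in S -> j \in S -> column_sum i j = rc N * (j == i)%:R.
Proof.
move=> gS iS jS.
suff /eqP : residual i j = 0.
  rewrite subr_eq0 => /eqP ->.
  by rewrite mulrA -rmorphM/= mulfV ?gt_eqF// rmorph1 mul1r.
pose rho := \sum_(j in S) sqnormc (residual i j).
suff rho0 : rho <= 0.
  have /eqP : rho = 0.
    by apply/eqP; rewrite eq_le rho0 sumr_ge0// => k _; exact: sqnormc_ge0.
  rewrite psumr_eq0; last by move=> k _; exact: sqnormc_ge0.
  by move=> /allP/(_ j); rewrite mem_index_enum jS sqnormc_eq0 => /(_ isT)/eqP.
have mL := measurable_level d mO S.
have Lx k x : level d Omega S x -> k \in S -> Omega (x + a k).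
  move=> [Ix xS] kS; move: kS; rewrite -{1}(xS : pattern d M Omega x = S) inE.
  by move=> /asboolP.
pose f (y : R) : R[i] :=
  \sum_(k in S) rc (\1_(level d Omega S) (y + - a k)) * residual i k.
have fE x k : level d Omega S x -> k \in S -> f (x + a k) = residual i k.
  move=> xL kS; rewrite /f (bigD1 k)//= addrK indicE mem_set// mul1r.
  rewrite big1 ?addr0// => m /andP[_ mk]; rewrite indicE memNset ?mul0r//.
  move=> mL'; move/eqP: mk; apply.
  have [Ix _] := xL; have [Im _] := mL'.
  by have [] := node_inj d_gt0 Im Ix (subrK _ _).
have fL2 : inL2 Omega f.
  apply: (inL2_bddmeas mO Ooo).
    apply: (bddmeas_eq (f := fun y => \sum_(k in S)
        \1_(level d Omega S) (y + - a k) * complex.Re (residual i k))).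
      move=> y _; rewrite /f Re_sum; apply: eq_bigr => k _.
      by case: (residual i k) => u v /=; rewrite mul0r subr0.
    apply: bddmeas_sum => k _.
    exact: (bddmeasM (bddmeas_indic_shift _ _ mL) (bddmeas_cst _ _)).
  apply: (bddmeas_eq (f := fun y => \sum_(k in S)
      \1_(level d Omega S) (y + - a k) * complex.Im (residual i k))).
    move=> y _; rewrite /f Im_sum; apply: eq_bigr => k _.
    by case: (residual i k) => u v /=; rewrite mul0r addr0.
  apply: bddmeas_sum => k _.
  exact: (bddmeasM (bddmeas_indic_shift _ _ mL) (bddmeas_cst _ _)).
have Loo : leb (level d Omega S) \is a fin_num.
  rewrite ge0_fin_numE ?measure_ge0//.
  apply: (@le_lt_trans _ _ (leb I)); last by rewrite leb_period// ltry.
  have sub : level d Omega S `<=` I by move=> x [].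
  exact: (@le_measure _ R (lebesgueR R) leb _ _ (mem_set mL) (mem_set mI) sub).
have L0 : 0 < fine (leb (level d Omega S)).
  have gS' : leb (level d Omega S) != 0%E := gS.
  by rewrite fine_gt0// lt0e gS' measure_ge0 -ge0_fin_numE ?measure_ge0.
(* On a fiber over the level set, [f] is the residual and the approximant is orthogonal to it, so
   the squared error there is at least [rho]; this is then integrated over the level set. *)
have bound (eps : R) : 0 < eps -> rho * fine (leb (level d Omega S)) < eps ^+ 2.
  move=> e0; have [s [c [sL]]] := dense fL2 e0.
  rewrite -lte_fin; apply: le_lt_trans.
  pose T y := \sum_(l <- s) c l * e_ Omega l y.
  pose h y := sqnormc (f y - T y).
  have mf : cmeasurable Omega f by have [] := fL2.
  have mT : cmeasurable Omega T.
    apply: cmeasurable_sum => l _; apply: cmeasurableM; first exact: cmeasurable_cst.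
    exact: cmeasurable_e_.
  have mh : measurable_fun Omega (h : lebesgueR R -> R).
    apply: measurable_sqnormc; apply: (cmeasurableD mf).
    apply: (@cmeasurable_eq _ _ (fun y => (-1) * T y)).
      by move=> y; rewrite mulN1r.
    exact: (cmeasurableM (cmeasurable_cst _ _) mT).
  have mh' := mh; rewrite -OmegaE in mh'.
  have mS := measurable_fiber_sum mP mh'.
  have h0 y : 0 <= h y by exact: sqnormc_ge0.
  have -> : sqnormL2 Omega (fun x => f x - \sum_(l <- s) c l * e_ Omega l x) =
      (\int[leb]_(x in I) (\sum_(k in pattern d M Omega x) h (x + a k))%:E)%E.
    by rewrite -(ge0_integral_fibered d_gt0 mP mh' h0) OmegaE.
  apply: (@le_trans _ _ (\int[leb]_(x in level d Omega S)
      (\sum_(k in pattern d M Omega x) h (x + a k))%:E)%E); last first.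
    apply: (@ge0_subset_integral _ (lebesgueR R) R leb _ _ mL mI).
    - exact/measurable_EFinP.
    - by move=> x _; rewrite lee_fin sumr_ge0.
    - by move=> x [].
  rewrite EFinM fineK// -(integral_cst leb mL rho%:E).
  apply: (@ge0_le_integral _ (lebesgueR R) R leb _ mL).
  - by move=> x _; rewrite lee_fin sumr_ge0// => k _; exact: sqnormc_ge0.
  - exact: measurable_cst.
  - by apply/measurable_EFinP; apply: (measurable_funS mI _ mS) => x [].
  move=> x xL; have [Ix xS] := xL; rewrite lee_fin (xS : pattern d M Omega x = S).
  rewrite /rho /h.
  have -> : \sum_(k in S) sqnormc (f (x + a k) - T (x + a k)) =
      \sum_(k in S) sqnormc (residual i k - T (x + a k)).
    by apply: eq_bigr => k kS; rewrite fE.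
  apply: le_sum_sqnormcB.
  have eT k : k \in S -> conjc (T (x + a k)) = \sum_(l <- s)
      conjc (c l * rc (Num.sqrt (fine (leb Omega)))^-1 * expi (2 * pi * l * x)) *
      conjc (expi (2 * pi * l * a k)).
    move=> kS; rewrite /T rmorph_sum /=; apply: eq_bigr => l _.
    rewrite e_E; last exact: Lx.
    by rewrite -conjcM -!mulrA -expiD; congr (conjc (_ * (_ * expi _))); ring.
  under eq_bigr => k kS do rewrite (eT k kS) mulr_sumr.
  rewrite exchange_big /= big1_seq// => l /andP[_ ls].
  under eq_bigr do rewrite mulrCA.
  by rewrite -mulr_sumr (residual_ortho gS iS (sL _ ls)) mulr0.
rewrite leNgt; apply/negP => rho_gt0.
have p0 : 0 < rho * fine (leb (level d Omega S)) by rewrite mulr_gt0.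
(* At this tolerance the bound would make a number smaller than itself. *)
have := bound (Num.sqrt (rho * fine (leb (level d Omega S)))).
by rewrite sqrtr_gt0 p0 sqr_sqrtr ?ltW// ltxx => /(_ isT).
Qed.

End column_orthogonality.

(** * Transport to a pattern *)

Lemma integral_leb_cst (R : realType) (D : set (lebesgueR R)) (r : \bar R) :
  measurable D -> (\int[leb]_(x in D) cst r x = r * leb D)%E.
Proof. by move=> mD; exact: (integral_cst leb mD r). Qed.

Section pattern_spectral.
Context {R : realType} (d : R) (M : nat).
Variables (Omega : set (lebesgueR R)) (Lambda : set R).
Hypotheses (d_gt0 : 0 < d) (mO : measurable Omega).
Hypotheses (O_gt0 : (0 < leb Omega)%E) (Ooo : (leb Omega < +oo)%E).
Hypothesis OmegaE : fibered d (@pattern R d M Omega) = Omega.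
Hypothesis ortho : forall l l', Lambda l -> Lambda l' ->
  innerL2 Omega (e_ Omega l) (e_ Omega l') = (l == l')%:R.
Hypothesis LambdaD : forall l (k : int), Lambda l -> Lambda (l + d * k%:~R).
Hypothesis dense : forall f, inL2 Omega f -> forall eps : R, 0 < eps ->
  exists (s : seq R) (c : R -> R[i]),
    (forall l, l \in s -> Lambda l) /\
    (sqnormL2 Omega (fun x => f x - \sum_(l <- s) c l * e_ Omega l x)%R
       < (eps ^+ 2)%:E)%E.
Variable G : seq R.
Hypothesis repG : representatives d Lambda G.

Notation rc := (real_complex R).
Notation a := (@node R d M).

Let I : set (lebesgueR R) := `[0, d^-1[%classic.
Let V := fine (leb Omega).
Let N := d * V.

Let lebOE : leb Omega = V%:E.
Proof. by rewrite fineK// ge0_fin_numE// ltW. Qed.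

Let V_gt0 : 0 < V.
Proof. by rewrite fine_gt0// O_gt0. Qed.

Let N_gt0 : 0 < N.
Proof. by rewrite mulr_gt0. Qed.

Let mI : measurable I.
Proof. exact: (borel_lebesgue (measurable_itv _)). Qed.

Let mP := @measurable_pattern_pattern R d M Omega mO.

Let gramE := gram d_gt0 mO O_gt0 Ooo OmegaE ortho LambdaD.

(** Some frequency is wanted in order to read the cardinality of [S] off the diagonal of the Gram
    matrix. Without one, the only combination is 0, at squared distance exactly V from the constant
    1. *)
Let Lambda_nonempty : exists l, Lambda l.
Proof.
apply: contrapT => nL.
have b1 : inL2 Omega (fun=> 1).
  by apply: (inL2_bddmeas mO Ooo); exact: bddmeas_cst.
have e0 : 0 < Num.sqrt V by rewrite sqrtr_gt0.
have [[|l s] [c [sL]]] := dense b1 e0; last first.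
  by have := nL; case; exists l; apply: sL; rewrite inE eqxx.
have -> : sqnormL2 Omega (fun x => 1 - \sum_(l <- [::]) c l * e_ Omega l x) =
    (\int[leb]_(x in Omega) cst 1%E x)%E.
  apply: eq_integral => x _; rewrite big_nil subr0.
  by rewrite -/(sqnormc 1) sqnormcE /= expr1n expr0n addr0.
by rewrite (integral_leb_cst 1%E mO) mul1e lebOE sqr_sqrtr ?ltxx// ltW.
Qed.

Variable S : {set 'I_(M.*2)}.
Hypothesis goodS : good d Omega S.

Let OS : set (lebesgueR R) := fibered d (fun=> S).

Let mPS : measurable_pattern d (fun=> S).
Proof.
move=> i; rewrite /piece; have [iS|iS] := boolP (i \in S).
  by rewrite (_ : I `&` _ = I)//; apply/setIidPl => x _ /=.
rewrite (_ : I `&` _ = set0); first exact: measurable0.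
by apply/seteqP; split => x // [_ /=]; exact/negP.
Qed.

Let mOS : measurable OS.
Proof. exact: measurable_fibered mPS. Qed.

Let cardS : #|S|%:R = N.
Proof.
have [l Ll] := Lambda_nonempty.
have := gramE goodS Ll Ll; rewrite subrr /gram_entry asboolT; last
  exact: congruent_refl.
rewrite /char_sum (eq_bigr (fun=> 1)); last by move=> i _; rewrite mulr0 mul0r expi0.
by rewrite sumr_const -(rmorph_nat rc) => /complexI.
Qed.

(** Both measures are N/d. Hence the normalizing factors in [e_] agree, and combinations pass from
    one set to the other with unchanged coefficients. *)
Lemma leb_fibered_good : leb OS = leb Omega.
Proof.
have := integral_leb_cst 1%E mOS; rewrite mul1e => <-.
have := integral_fibered d_gt0 mPS (bddmeas_cst OS 1); rewrite -/OS /= => ->.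
have e : {in I, (fun x : R => (\sum_(i in S) (1 : R))%:E) =1 cst N%:E}.
  by move=> x _; rewrite sumr_const cardS.
rewrite (eq_integral _ _ e) (integral_leb_cst _ mI) leb_period// -EFinM lebOE.
by congr (_%:E); rewrite /N mulrAC mulfV ?mul1r// gt_eqF.
Qed.

Let OSoo : (leb OS < +oo)%E.
Proof. by rewrite leb_fibered_good. Qed.

Let integral_fibers_ae (h : R -> R) : (forall D, bddmeas D h) ->
  (forall x T, good d Omega T ->
    \sum_(i in S) h (x + a i) = \sum_(i in T) h (x + a i)) ->
  (\int[leb]_(y in OS) (h y)%:E = \int[leb]_(y in Omega) (h y)%:E)%E.
Proof.
move=> bh hS; rewrite -OmegaE (integral_fibered d_gt0 mPS (bh _)).
rewrite (integral_fibered d_gt0 mP (bh _)).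
apply: (@ae_eq_integral _ (lebesgueR R) R leb I _ _ mI).
- by apply/measurable_EFinP; have [] := bddmeas_fiber_sum mPS (bh (fibered d _)).
- by apply/measurable_EFinP; have [] := bddmeas_fiber_sum mP (bh (fibered d _)).
have := ae_good d M mO; apply: filterS => x gx Ix.
by congr (_%:E); apply: hS; exact: gx.
Qed.

(** Folded onto the period, both inner products integrate fiber sums which agree wherever the
    pattern of [x] is good, that is, almost everywhere. *)
Lemma ortho_fibered l l' : Lambda l -> Lambda l' ->
  innerL2 OS (e_ OS l) (e_ OS l') = (l == l')%:R.
Proof.
move=> Ll Ll'; rewrite -(ortho Ll Ll').
rewrite (innerL2_e_ _ _ mOS OSoo) (innerL2_e_ _ _ mO Ooo).
have hc : (\int[leb]_(y in OS) (cos (2 * pi * (l - l') * y))%:E =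
    \int[leb]_(y in Omega) (cos (2 * pi * (l - l') * y))%:E)%E.
  apply: integral_fibers_ae => [D|x T gT]; first exact: bddmeas_cos.
  by have [] := sum_trig_gram gramE x goodS gT Ll Ll'.
have hs : (\int[leb]_(y in OS) (sin (2 * pi * (l - l') * y))%:E =
    \int[leb]_(y in Omega) (sin (2 * pi * (l - l') * y))%:E)%E.
  apply: integral_fibers_ae => [D|x T gT]; first exact: bddmeas_sin.
  by have [] := sum_trig_gram gramE x goodS gT Ll Ll'.
by rewrite /Rintegral hc hs leb_fibered_good.
Qed.

Variable f : R -> R[i].
Hypothesis fL2 : inL2 OS f.

(** Extension by 0: [f] is measurable on [OS] only, while its translates are needed on the whole
    line. *)
Let f0 (y : R) : R[i] := rc (\1_OS y) * f y.

(** Kernel of expansion on the fiber [S] followed by evaluation at any node. By [column_ortho] it is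
    the identity matrix on [S]. *)
Let K (i j : 'I_(M.*2)) : R[i] := rc N^-1 * column_sum d G i j.

(* On each fiber, expand [f] in the characters of the fiber [S] and evaluate the
   same combination of exponentials on the fiber of [Omega]. *)
Definition transported (y : R) : R[i] :=
  \sum_j rc (\1_I (y + - a j)) * \sum_(i in S) f0 (y + - a j + a i) * K i j.

Let transportedE x j : I x ->
  transported (x + a j) = \sum_(i in S) f (x + a i) * K i j.
Proof.
move=> Ix; rewrite /transported (bigD1 j)//= addrK indicE mem_set// mul1r.
rewrite [X in _ + X]big1 ?addr0; last first.
  move=> k kj; rewrite indicE memNset ?mul0r// => Ik; move/eqP: kj; apply.
  by have [] := node_inj d_gt0 Ik Ix (subrK _ _).
apply: eq_bigr => i iS; rewrite /f0 indicE mem_set ?mul1r//.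
by exists x => //; exists i.
Qed.

Let cmeasurable_transported D : cmeasurable D transported.
Proof.
have [rf jf _] := fL2.
have mf0 : cmeasurable setT f0 by apply: (cmeasurable_restrict mOS).
apply: cmeasurable_sum => j _; apply: cmeasurableM.
  by apply: cmeasurable_real; have [] := bddmeas_indic_shift D (- a j) mI.
apply: cmeasurable_sum => i _; apply: cmeasurableM; last exact: cmeasurable_cst.
apply: (@cmeasurable_eq _ _ (fun y => f0 (y + (- a j + a i)))).
  by move=> y; rewrite addrA.
exact: cmeasurable_shift.
Qed.

Let c0 := (Num.sqrt V)^-1.

(** Both sides are squared norms of one combination of exponentials of Lambda, evaluated on the
    fibers [T] and [S]; on [S], orthogonality of the columns turns its first part back into [f]. *)
Let transported_fiber (s : seq R) (c : R -> R[i]) x (T : {set 'I_(M.*2)}) :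
  (forall l, l \in s -> Lambda l) -> I x -> good d Omega T ->
  \sum_(j in T) sqnormc (transported (x + a j) -
     \sum_(l <- s) c l * (rc c0 * expi (2 * pi * l * (x + a j)))) =
  \sum_(j in S) sqnormc (f (x + a j) -
     \sum_(l <- s) c l * (rc c0 * expi (2 * pi * l * (x + a j)))).
Proof.
move=> sL Ix gT; have [_ LG _ _] := repG.
(* [b g] is the coefficient of [f] along the character of [g] on the fiber over this [x]. Appending
   the negated approximant to the list makes the whole difference a combination of exponentials of
   Lambda. *)
pose b g := rc N^-1 * \sum_(i in S) f (x + a i) * expi (- (2 * pi * g * (x + a i))).
pose L := [seq (g, b g) | g <- G] ++ [seq (l, - (c l * rc c0)) | l <- s].
have LL p : p \in L -> Lambda p.1.
  by rewrite mem_cat => /orP[] /mapP[l lG ->] /=; [exact: LG|exact: sL].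
have expand j : \sum_(p <- L) p.2 * expi (2 * pi * p.1 * (x + a j)) =
    transported (x + a j) -
     \sum_(l <- s) c l * (rc c0 * expi (2 * pi * l * (x + a j))).
  rewrite big_cat !big_map /= transportedE//; congr (_ + _); last first.
    rewrite -sumrN; apply: eq_bigr => l _.
    by rewrite mulNr mulrA.
  rewrite /K /column_sum; under [RHS]eq_bigr do rewrite mulrCA mulr_sumr mulr_sumr.
  rewrite [RHS]exchange_big /=; apply: eq_bigr => g _.
  rewrite /b mulr_sumr mulr_suml; apply: eq_bigr => i _.
  rewrite -!mulrA -expiD; congr (_ * (_ * expi _)); ring.
under eq_bigr do rewrite -expand.
rewrite (sum_sqnormc_gram gramE x gT goodS LL).
apply: eq_bigr => j jS; rewrite expand transportedE//.
congr (sqnormc (_ - _)); rewrite (bigD1 j)//= big1 ?addr0.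
  rewrite /K (column_ortho d_gt0 mO O_gt0 Ooo OmegaE gramE dense repG goodS)//.
  by rewrite eqxx mulr1 -rmorphM/= mulVf ?gt_eqF// rmorph1 mulr1.
move=> i /andP[iS ij].
rewrite /K (column_ortho d_gt0 mO O_gt0 Ooo OmegaE gramE dense repG goodS)//.
by rewrite eq_sym (negPf ij) !mulr0.
Qed.

Lemma sqnormL2_transported (s : seq R) (c : R -> R[i]) :
  (forall l, l \in s -> Lambda l) ->
  sqnormL2 Omega (fun x => transported x - \sum_(l <- s) c l * e_ Omega l x) =
  sqnormL2 OS (fun x => f x - \sum_(l <- s) c l * e_ OS l x).
Proof.
move=> sL.
have mB D (D' : set (lebesgueR R)) (u : R -> R[i]) : measurable D' -> cmeasurable D u ->
    measurable_fun D ((fun x => sqnormc (u x - \sum_(l <- s) c l * e_ D' l x))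
      : lebesgueR R -> R).
  move=> mD' mu; apply: measurable_sqnormc; apply: (cmeasurableD mu).
  apply: (@cmeasurable_eq _ _ (fun y => (-1) * \sum_(l <- s) c l * e_ D' l y)).
    by move=> y; rewrite mulN1r.
  apply: (cmeasurableM (cmeasurable_cst _ _)); apply: cmeasurable_sum => l _.
  by apply: cmeasurableM; [exact: cmeasurable_cst|exact: cmeasurable_e_].
have mf : cmeasurable OS f by have [] := fL2.
pose h1 x := sqnormc (transported x - \sum_(l <- s) c l * e_ Omega l x).
pose h2 x := sqnormc (f x - \sum_(l <- s) c l * e_ OS l x).
have mh1 : measurable_fun (fibered d (pattern d M Omega)) (h1 : lebesgueR R -> R).
  by rewrite OmegaE; exact: (mB _ _ _ mO (cmeasurable_transported Omega)).
have mh2 : measurable_fun OS (h2 : lebesgueR R -> R) by exact: (mB _ _ _ mOS mf).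
have e1 := ge0_integral_fibered d_gt0 mP mh1 (fun y => sqnormc_ge0 _).
have e2 := ge0_integral_fibered d_gt0 mPS mh2 (fun y => sqnormc_ge0 _).
rewrite OmegaE in e1.
apply: (etrans e1); apply: etrans (esym e2).
apply: (@ae_eq_integral _ (lebesgueR R) R leb I _ _ mI).
- by apply/measurable_EFinP; exact: (measurable_fiber_sum mP mh1).
- by apply/measurable_EFinP; exact: (measurable_fiber_sum mPS mh2).
have := ae_good d M mO; apply: filterS => x gx Ix.
congr (_%:E).
have := transported_fiber c sL Ix (gx Ix) => h.
transitivity (\sum_(j in pattern d M Omega x) sqnormc (transported (x + a j) -
     \sum_(l <- s) c l * (rc c0 * expi (2 * pi * l * (x + a j))))).
  apply: eq_bigr => j jP; congr (sqnormc (_ - _)); apply: eq_bigr => l _.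
  by rewrite e_E//; move: jP; rewrite inE => /asboolP.
rewrite h; apply: eq_bigr => j jS; congr (sqnormc (_ - _)); apply: eq_bigr => l _.
rewrite e_E ?leb_fibered_good//.
by exists x => //; exists j.
Qed.

Lemma dense_fibered (eps : R) : 0 < eps ->
  exists (s : seq R) (c : R -> R[i]),
    (forall l, l \in s -> Lambda l) /\
    (sqnormL2 OS (fun x => f x - \sum_(l <- s) c l * e_ OS l x)%R
       < (eps ^+ 2)%:E)%E.
Proof.
move=> e0.
have tL2 : inL2 Omega transported.
  have [rt jt] := cmeasurable_transported Omega; split => //.
  (* For the empty combination the isometry equates the norms of [transported] and [f], so the
     former is finite. *)
  have nilL (l : R) : l \in [::] -> Lambda l by [].
  have := sqnormL2_transported (fun=> 0) nilL.
  have eN (u : R -> R[i]) (D : set (lebesgueR R)) :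
      sqnormL2 D (fun x => u x - \sum_(l <- [::]) 0 * e_ D l x) = sqnormL2 D u.
    by apply: eq_integral => x _; rewrite big_nil subr0.
  by rewrite !eN => ->; have [] := fL2.
have [s [c [sL h]]] := dense tL2 e0.
exists s, c; split; first exact: sL.
by rewrite -(sqnormL2_transported c sL); exact: h.
Qed.

End pattern_spectral.

(** * Spectral patterns *)

Lemma periodic_setD (R : realType) (d : R) (Lambda : set R) l (k : int) :
  periodic_set d Lambda -> Lambda l -> Lambda (l + d * k%:~R).
Proof.
move=> [gamma ->] [g gG [_ [m _ <-] <-]]; exists g => //.
by exists (d * (m + k)%:~R); [exists (m + k)|rewrite intrD mulrDr addrA].
Qed.

Lemma bounded_fibered (R : realType) (d : R) (Omega : set R) : 0 < d ->
  bounded_set Omega ->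
  exists M, fibered d (pattern d M (Omega : set (lebesgueR R))) = Omega.
Proof.
move=> d0 [C0 [_ hC0]].
(* [bounded_set] bounds Omega by every number strictly above [C0]. *)
pose C := `|C0| + 1.
have C0C : C0 < C by rewrite (le_lt_trans (ler_norm _))// ltrDl.
have hC y : Omega y -> `|y| <= C by exact: hC0.
pose M := (Num.truncn (d * C)).+1; exists M.
have dCM : d * C < M%:R by exact: truncnS_gt.
apply/seteqP; split => [_ [x _ [i + ->]]|y Oy].
  by rewrite inE => /asboolP.
have dy : `|d * y| < M%:R.
  by rewrite normrM gtr0_norm// (le_lt_trans _ dCM)// ler_wpM2l ?hC// ltW.
have /andP[dy1 dy2] : - M%:R < d * y < M%:R by rewrite -ltr_norml.
(* The integer part of [t], which lies in [0, 2M), is the index of the node; its fractional part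
   divided by [d] is the point of the period. *)
pose t := d * y + M%:R.
have t0 : 0 <= t by rewrite /t; lra.
have /andP[it ti] := truncn_itv t0.
have iM : (Num.truncn t < M.*2)%N.
  rewrite -(ltr_nat R) (le_lt_trans it)// /t -addnn natrD; lra.
pose i := Ordinal iM.
have xE : y = (y - node d i) + node d i by rewrite subrK.
exists (y - node d i).
  have e : d * (y - node d i) = t - (Num.truncn t)%:R.
    by rewrite /t /node /=; field; exact: lt0r_neq0.
  rewrite /= in_itv/=; apply/andP; split.
    by rewrite -(pmulr_rge0 _ d0) e subr_ge0.
  by rewrite -(ltr_pM2l d0) e mulfV ?gt_eqF// ltrBlDr addrC natr1.
by exists i => //; rewrite inE -xE; exact/asboolP.
Qed.

Lemma spectral_pair_fibered (R : realType) (d : R) (M : nat)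
    (Omega : set (lebesgueR R)) (Lambda : set R) (S : {set 'I_(M.*2)}) :
  0 < d -> fibered d (pattern d M Omega) = Omega ->
  spectral_pair Omega Lambda -> periodic_set d Lambda -> good d Omega S ->
  spectral_pair (fibered d (fun=> S)) Lambda.
Proof.
move=> d0 OmegaE [mO hO [_ ortho dense]] per gS.
have /andP[h0 hoo] := hO.
have LD l k := @periodic_setD R d Lambda l k per.
have [G repG] := periodic_representatives per.
have lebE := leb_fibered_good d0 mO h0 hoo OmegaE ortho LD dense gS.
have mS : measurable (fibered d (fun=> S)).
  apply: measurable_fibered => i; rewrite /piece.
  have mI : measurable (`[0, d^-1[%classic : set (lebesgueR R)).
    exact: (borel_lebesgue (measurable_itv _)).
  have [iS|iS] := boolP (i \in S).
    by rewrite (_ : _ `&` _ = `[0, d^-1[%classic)//; apply/setIidPl => x _ /=.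
  rewrite (_ : _ `&` _ = set0); first exact: measurable0.
  by apply/seteqP; split => x // [_ /=]; exact/negP.
have Soo : (leb (fibered d (fun=> S)) < +oo)%E by rewrite lebE.
split; first exact: mS.
  by rewrite lebE h0 hoo.
split.
- by move=> l _; exact: (inL2_e_ l mS Soo).
- exact: (ortho_fibered d0 mO h0 hoo OmegaE ortho LD dense gS).
- exact: (dense_fibered d0 mO h0 hoo OmegaE ortho LD dense repG gS).
Qed.

(** * Assembling the partition *)

Lemma ae_lebS (R : realType) (P Q : R -> Prop) : (forall x, P x -> Q x) ->
  {ae @leb R, forall x, P x} -> {ae @leb R, forall x, Q x}.
Proof.
move=> PQ [N [mN N0 PN]]; exists N; split; [exact: mN|exact: N0|].
by move=> x /= nQ; apply: PN => /PQ.
Qed.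

Lemma ae_shift (R : realType) (P : R -> Prop) (t : R) :
  {ae @leb R, forall x, P x} -> {ae @leb R, forall x, P (x + t)}.
Proof.
move=> [N [mN N0 PN]]; exists ((fun x => x + t) @^-1` N); split.
- exact: measurable_preimage_shift.
- by rewrite -N0; exact: leb_preimage_shift.
- by move=> x /= nP; exact: PN.
Qed.

Theorem theorem1p5 (R : realType) (Omega Lambda : set R) (d : R)
    (d_gt0 : 0 < d)
    (bndOmega : bounded_set Omega)
    (spOmega : spectral_pair Omega Lambda)
    (perLambda : periodic_set d Lambda) :
  exists (k : nat) (E A : 'I_k -> set R),
    [/\ classical_sets.partition [set: 'I_k] E `[0, d^-1[,
        forall j, lebesgue_measurable (E j),
        forall j, A j `<=` scaledZ d^-1,
        {ae (@leb R), forall x,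
           Omega x <-> (\bigcup_j minkowski_sum (E j) (A j)) x} &
        forall j, spectral_pair (minkowski_sum `[0, d^-1[ (A j)) Lambda].
Proof.
have [M OmegaE] := bounded_fibered d_gt0 bndOmega.
have [mO _ _] := spOmega.
pose O : set (lebesgueR R) := Omega.
have aeg := @ae_good R d M O mO.
(* If every pattern were null, the period would be null, while its measure is 1/d. *)
have [S0 gS0] : exists S : {set 'I_(M.*2)}, good d O S.
  apply: contrapT => nS.
  have [N [mN N0 IN]] := aeg.
  have I0 : leb (`[0, d^-1[%classic : set R) = 0%E.
    apply: (@subset_measure0 _ (lebesgueR R) R leb _ N) => //.
      exact: (borel_lebesgue (measurable_itv _)).
    by move=> x Ix; apply: IN => /= /(_ Ix) gx; apply: nS; exists (pattern d M O x).
  by move: I0; rewrite leb_period// => -[] /eqP; rewrite invr_eq0 gt_eqF.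
(* Null patterns are redirected to [S0], so that every class has positive
   measure. *)
pose fix_good (S : {set 'I_(M.*2)}) := if good d O S then S else S0.
pose C := [set S : {set 'I_(M.*2)} | good d O S]%SET.
have fixC S : fix_good S \in C.
  by rewrite inE /fix_good; case: ifP.
pose E (j : 'I_#|C|) : set R :=
  [set x | `[0, d^-1[%classic x /\ fix_good (pattern d M O x) = enum_val j].
pose A (j : 'I_#|C|) : set R := [set node d i | i in [set` enum_val j]].
have gj (j : 'I_#|C|) : good d O (enum_val j).
  by have := enum_valP j; rewrite inE.
have AE (j : 'I_#|C|) : minkowski_sum `[0, d^-1[ (A j) = fibered d (fun=> enum_val j).
  apply/seteqP; split => y.
    by move=> [x Ix [_ [i iS <-] <-]]; exists x => //; exists i.
  by move=> [x Ix [i iS ->]]; exists x => //; exists (node d i) => //; exists i.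
exists #|C|, E, A; split.
- split.
  + apply/seteqP; split => [x [j _ []]//|x Ix].
    exists (enum_rank_in (fixC S0) (fix_good (pattern d M O x))) => //.
    by split => //; rewrite enum_rankK_in.
  + move=> i j _ _ [x [[_ xi] [_ xj]]].
    by apply: enum_val_inj; rewrite -xi -xj.
  (* A class contains the level set of its good pattern, which has positive measure and so is
     nonempty. *)
  + move=> j _; apply/set0P/eqP => Ej0; move/negP: (gj j); apply.
    rewrite (_ : level d O (enum_val j) = set0) ?measure0//.
    apply/seteqP; split => x // [Ix xS].
    rewrite -[set0]Ej0; split => //.
    by rewrite (xS : pattern d M O x = _) /fix_good gj.
- move=> j.
  have -> : E j = \bigcup_(S in [set S | fix_good S = enum_val j]) level d O S.
    apply/seteqP; split => [x [Ix xS]|x [S SE [Ix xS]]].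
      by exists (pattern d M O x).
    by split => //; rewrite (xS : pattern d M O x = S).
  apply: fin_bigcup_measurable; first exact: finite_finset.
  by move=> S _; exact: measurable_level.
- move=> j _ [i _ <-]; exists (i%:Z - M%:Z) => //.
  by rewrite intrB -!pmulrn /node mulrC.
(* A point is exceptional when one of its translates by [- node d i] lands in the period on a null
   pattern: such points lie in a finite union of translates of a null set. *)
- have h : {ae @leb R, forall x (i : 'I_(M.*2)), `[0, d^-1[%classic (x + - node d i) ->
      good d O (pattern d M O (x + - node d i))}.
    by apply: filter_forall => i; exact: (ae_shift (- node d i) aeg).
  apply: ae_lebS h => y hy; split.
    rewrite -{1}OmegaE => -[x Ix [i ix yE]].
    have xE : x = y + - node d i by rewrite yE addrK.
    have gx : good d O (pattern d M O x) by rewrite xE; apply: hy; rewrite -xE.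
    exists (enum_rank_in (fixC S0) (fix_good (pattern d M O x))) => //.
    exists x; first by split => //; rewrite enum_rankK_in.
    exists (node d i); last by [].
    by exists i => //=; rewrite enum_rankK_in// /fix_good gx.
  move=> [j _ [x [Ix xS] [_ [i iS <-] xy]]].
  have xE : x = y + - node d i by rewrite -xy addrK.
  have gx : good d O (pattern d M O x) by rewrite xE; apply: hy; rewrite -xE.
  move: xS; rewrite /fix_good gx => xS; move: iS; rewrite /= -xS inE => /asboolP.
  by rewrite xy.
- move=> j; rewrite AE.
  exact: (spectral_pair_fibered d_gt0 OmegaE spOmega perLambda (gj j)).
Qed.
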